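(* Assume that $U$ is a compact subset of a Polish space $(\mathcal U,d_{\mathcal U})$ and that $f:\mathbb R^n\times U\to T\mathbb R^n$, $f(x,u)=(x,\hat f(x,u))$, is Lipschitz continuous, i.e. there is $L_f>0$ with $d_{T\mathbb R^n}(f(x,u_1),f(y,u_2))\le L_f(\|x-y\|_{\mathbb R^n}+d_{\mathcal U}(u_1,u_2))$ for all $x,y\in\mathbb R^n$, $u_1,u_2\in U$. Fix $\bar\mu\in\mathcal P_c(\mathbb R^n)$. Let $(\tilde u_k)_{k\in\mathbb N}$ be a sequence of uniformly $\mathcal W$-Lipschitz continuous measure controls, and assume there exists a measure control $\tilde u$ such that $$\lim_{k\to+\infty}\ \sup_{\mu\in\mathcal P_c(\mathbb R^n)}\mathcal W_{\mathbb R^n\times U}(\tilde u_k[\mu],\tilde u[\mu])=0.$$ For each $k$ let $\mu_k$ be a solution to $\dot\mu=V^{\tilde u_k}[\mu]$ with $\mu(0)=\bar\mu$ obtained as limit of Lattice Approximate Solutions (LAS), and let $\mu$ be a solution to $\dot\mu=V^{\tilde u}[\mu]$ with $\mu(0)=\bar\mu$ obtained as limit of LAS. Then, for every $t\ge0$, $$\lim_{k\to+\infty}W_{\mathbb R^n}(\mu_k(t),\mu(t))=0.$$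
   Context: $T\mathbb R^n$ is identified with $\mathbb R^n\times\mathbb R^n$ (pairs $(x,v)$, base point and velocity), with $d_{T\mathbb R^n}$ the Euclidean distance on $\mathbb R^{2n}$. For a Polish space $(X,d)$, $\mathcal P(X)$ is the set of Borel probability measures on $X$, $\mathcal P_c(X)$ the subset of those with compact support, and $\phi_{\#}\mu$ is the pushforward. $\mathcal T(\mu_1,\mu_2)$ is the set of transference plans (couplings) of $\mu_1,\mu_2\in\mathcal P(X)$, $W_X(\mu_1,\mu_2)=\min_{\tau\in\mathcal T(\mu_1,\mu_2)}\int_{X\times X} d(x,y)\,d\tau(x,y)$ is the ($1$-)Wasserstein distance, and $\mathcal T^{opt}(\mu_1,\mu_2)$ is the set of plans attaining the minimum. A measure control is a map $\tilde u:\mathcal P(\mathbb R^n)\to\mathcal P(\mathbb R^n\times U)$ with $(\pi_1)_{\#}(\tilde u[\mu])=\mu$ for every $\mu\in\mathcal P(\mathbb R^n)$, where $\pi_1$ is the projection onto $\mathbb R^n$. Its associated measure vector field is $V^{\tilde u}:\mathcal P(\mathbb R^n)\to\mathcal P(T\mathbb R^n)$, $V^{\tilde u}[\mu]=f_{\#}(\tilde u[\mu])$. For $\nu_1,\nu_2\in\mathcal P(\mathbb R^n\times U)$ with first marginals $\mu_i=(\pi_1)_{\#}\nu_i$, define the Wasserstein pseudo-distance $$\mathcal W_{\mathbb R^n\times U}(\nu_1,\nu_2)=\inf\Big\{\int_{(\mathbb R^n\times U)^2} d_{\mathcal U}(u_1,u_2)\,dT(x,u_1,y,u_2): T\in\mathcal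 T(\nu_1,\nu_2),\ (\pi_{1,3})_{\#}T\in\mathcal T^{opt}(\mu_1,\mu_2)\Big\},$$ where $\pi_{1,3}(x,u_1,y,u_2)=(x,y)$ and optimality is with respect to $W_{\mathbb R^n}$. The sequence $(\tilde u_k)$ is uniformly $\mathcal W$-Lipschitz continuous if there is $C>0$ such that $\mathcal W_{\mathbb R^n\times U}(\tilde u_k[\mu],\tilde u_k[\nu])\le C\,W_{\mathbb R^n}(\mu,\nu)$ for every $k\in\mathbb N$ and $\mu,\nu\in\mathcal P_c(\mathbb R^n)$. A measure vector field is a map $V:\mathcal P(\mathbb R^n)\to\mathcal P(T\mathbb R^n)$ with $(\pi_1)_{\#}V[\mu]=\mu$ for all $\mu$. A solution to $\dot\mu=V[\mu]$, $\mu(0)=\bar\mu$, is a map $\mu:[0,+\infty)\to\mathcal P(\mathbb R^n)$ with $\mu(0)=\bar\mu$ such that, on every interval $[0,T]$ and for every $g\in C_c^\infty(\mathbb R^n)$: the integral $\int_{T\mathbb R^n}(\nabla g(x)\cdot v)\,dV[\mu(s)](x,v)$ is defined for a.e. $s\in[0,T]$; the map $s\mapsto\int_{T\mathbb R^n}(\nabla g(x)\cdot v)\,dV[\mu(s)](x,v)$ belongs to $L^1([0,T])$; and the map $t\mapsto\int_{\mathbb R^n} g\,d\mu(t)$ is absolutely continuous and satisfies $\frac{d}{dt}\int_{\mathbb R^n} g\,d\mu(t)=\int_{T\mathbb R^n}(\nabla g(x)\cdot v)\,dV[\mu(t)](x,v)$ for a.e. $t\in[0,T]$. Lattice Approximate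 Solutions. Let $N\in\mathbb N\setminus\{0\}$, let $x_i$ range over $\frac{\mathbb Z^n}{N^2}\cap[-N,N]^n$ and $v_j$ over $\frac{\mathbb Z^n}{N}\cap[-N,N]^n$, and put $Q=[0,\frac1{N^2})^n$, $Q'=[0,\frac1N)^n$. For a measure vector field $V$ and $\bar\mu\in\mathcal P_c(\mathbb R^n)$, the LAS $\mu^N$ is defined recursively by $\mu^N(0)=\sum_i\bar\mu(x_i+Q)\,\delta_{x_i}$ and, for $\ell=0,1,2,\dots$ and $t\in[\frac{\ell}{N},\frac{\ell+1}{N}]$, $$\mu^N(t)=\sum_i\sum_j m^v_{ij}\Big(V\big[\mu^N(\tfrac{\ell}{N})\big]\Big)\,\delta_{x_i+(t-\frac{\ell}{N})v_j},\qquad m^v_{ij}(V[\mu])=V[\mu]\big(\{(x_i,v):v\in v_j+Q'\}\big).$$ (On a given interval $[0,T]$, $N$ is taken large enough that the grids capture all the mass, so that $\mu^N(t)$ is a probability measure.) A solution $\mu$ of $\dot\mu=V[\mu]$, $\mu(0)=\bar\mu$ is obtained as limit of LAS if, for every $T>0$, $\lim_{N\to+\infty}\sup_{t\in[0,T]}W_{\mathbb R^n}(\mu^N(t),\mu(t))=0$. *)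

(* Defs.v *)
From HB Require Import structures.
From mathcomp Require Import all_boot all_order all_algebra.
From mathcomp Require Import all_classical all_reals all_analysis giry.
From mathcomp Require Import ring.

Set Implicit Arguments.
Unset Strict Implicit.
Unset Printing Implicit Defensive.

Import Order.TTheory GRing.Theory Num.Theory.
Import numFieldNormedType.Exports.

Local Open Scope classical_set_scope.
Local Open Scope ring_scope.

HB.instance Definition _ (X Y : ptopologicalType) :=
  Topological.on (X * Y)%type.

Definition borel (X : ptopologicalType) := g_sigma_algebraType (@open X).

Definition polish (R : realType) (X : metricType R) :=
  (exists2 D : set X, countable D & dense D) /\
  (forall F : set_system X, ProperFilter F -> cauchy F -> exists x : X, F --> x).

(* The subset A as a space of its own, with the induced topology. The chosen
   element a only provides the point that measurable types must have. *)
Definition subset_space (X : topologicalType) (A : set X) (a : A) : Type := A.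
HB.instance Definition _ (X : topologicalType) (A : set X) (a : A) :=
  Topological.on (subset_space a).
HB.instance Definition _ (X : topologicalType) (A : set X) (a : A) :=
  isPointed.Build (subset_space a) a.

Definition subset_val (X : topologicalType) (A : set X) (a : A)
  (x : subset_space a) : X := set_val (x : A).

(* A probability is a function on all sets, Borel or not, so two of them are
   the same Borel measure when they are related by measure_eq (equality on
   measurable sets), which is weaker than Leibniz equality. *)
Definition Prob (R : realType) (X : ptopologicalType) := probability (borel X) R.

Definition support (R : realType) (X : ptopologicalType) (mu : Prob R X)
  : set X := [set x | forall O : set X, open O -> O x -> (0 < mu O)%E].

Definition ProbC (R : realType) (X : ptopologicalType) : set (Prob R X) :=
  [set mu | compact (support mu)].

Lemma continuous_measurable_borel (X Y : ptopologicalType) (f : X -> Y) :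
  continuous f -> measurable_fun [set: borel X] (f : borel X -> borel Y).
Proof.
move=> /continuousP cf.
apply: (@measurability _ _ (borel X) (borel Y) setT f (@open Y)) => //.
move=> _ [B oB <-]; rewrite setTI.
by apply: sub_sigma_algebra; exact: cf.
Qed.

Definition push (R : realType) (X Y : ptopologicalType) (f : X -> Y)
    (cf : continuous f) (mu : Prob R X) : Prob R Y :=
  distribution mu (mfun_Sub (mem_set (continuous_measurable_borel cf))).

Lemma continuous_fst (X Y : topologicalType) : continuous (@fst X Y).
Proof. by move=> x; exact: cvg_fst. Qed.

Lemma continuous_snd (X Y : topologicalType) : continuous (@snd X Y).
Proof. by move=> x; exact: cvg_snd. Qed.

Definition proj13 (X Y : Type) (p : (X * Y) * (X * Y)) : X * X :=
  (p.1.1, p.2.1).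

Lemma continuous_proj13 (X Y : topologicalType) : continuous (@proj13 X Y).
Proof.
move=> p; apply: cvg_pair.
- exact: (continuous_comp (@continuous_fst _ _ p) (@continuous_fst _ _ _)).
- exact: (continuous_comp (@continuous_snd _ _ p) (@continuous_fst _ _ _)).
Qed.

Definition marg1 (R : realType) (X Y : ptopologicalType)
    (nu : Prob R (X * Y)%type) : Prob R X := push (@continuous_fst X Y) nu.

Definition marg2 (R : realType) (X Y : ptopologicalType)
    (nu : Prob R (X * Y)%type) : Prob R Y := push (@continuous_snd X Y) nu.

Section Transport.
Context {R : realType} {X : ptopologicalType}.
Variable dist : X -> X -> R.

Definition coupling (mu1 mu2 : Prob R X) : set (Prob R (X * X)%type) :=
  [set tau | measure_eq (marg1 tau) mu1 /\ measure_eq (marg2 tau) mu2].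

Definition cost (tau : Prob R (X * X)%type) : \bar R :=
  (\int[tau]_p (dist p.1 p.2)%:E)%E.

Definition wasserstein (mu1 mu2 : Prob R X) : \bar R :=
  ereal_inf [set cost tau | tau in coupling mu1 mu2].

Definition optimal_plan (mu1 mu2 : Prob R X) : set (Prob R (X * X)%type) :=
  [set tau | coupling mu1 mu2 tau /\
             forall tau', coupling mu1 mu2 tau' -> (cost tau <= cost tau')%E].

End Transport.

Section Euclidean.
Context {R : realType} {n : nat}.
Local Notation Rn := 'rV[R]_n.

(* The library norm on row vectors is the sup norm; it induces the same
   topology, hence the same Borel sets, but not the same distances. *)
Definition enorm (x : Rn) : R := Num.sqrt (\sum_j x 0 j ^+ 2).

Definition edist (x y : Rn) : R := enorm (x - y).

Definition tdist (p q : Rn * Rn) : R :=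
  Num.sqrt (enorm (p.1 - q.1) ^+ 2 + enorm (p.2 - q.2) ^+ 2).

Definition WRn : Prob R Rn -> Prob R Rn -> \bar R := wasserstein edist.

Definition basis_vec (i : 'I_n) : Rn := delta_mx 0 i.

Definition partial (i : 'I_n) (g : Rn -> R) : Rn -> R := 'D_(basis_vec i) g.

Definition partials (s : seq 'I_n) (g : Rn -> R) : Rn -> R := foldr partial g s.

Definition smooth (g : Rn -> R) := forall s : seq 'I_n,
  continuous (partials s g) /\
  forall (i : 'I_n) (x : Rn), derivable (partials s g) x (basis_vec i).

(* C_c^oo(R^n) *)
Definition test_function (g : Rn -> R) :=
  smooth g /\ compact (closure [set x | g x != 0]).

Definition grad_dot (g : Rn -> R) (p : Rn * Rn) : R :=
  \sum_j partial j g p.1 * p.2 0 j.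

End Euclidean.

Definition ae_on (R : realType) (T : R) (P : R -> Prop) :=
  {ae lebesgue_measure, forall s : R, 0 <= s <= T -> P s}.

(* lebesgue_measure lives on the Borel sets of R, so membership in L^1([0, T])
   of a function (possibly defined only almost everywhere) is expressed through
   a Borel representative. *)
Definition in_L1 (R : realType) (T : R) (F : R -> R) :=
  exists2 h : R -> R,
    lebesgue_measure.-integrable `[0, T] (EFin \o h) &
    ae_on T (fun s => h s = F s).

Definition absolutely_continuous (R : realType) (T : R) (F : R -> R) :=
  forall e : R, 0 < e -> exists2 d : R, 0 < d &
    forall (m : nat) (l r : 'I_m -> R),
      (forall i, [/\ 0 <= l i, l i <= r i & r i <= T]) ->
      (forall i j, i != j -> r i <= l j \/ r j <= l i) ->
      \sum_i (r i - l i) < d -> \sum_i `|F (r i) - F (l i)| < e.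

Section MeasureDifferentialEquations.
Context {R : realType} {n : nat}.
Local Notation Rn := 'rV[R]_n.
Local Notation TRn := (Rn * Rn)%type.

(* Only the values mu t with 0 <= t matter. *)
Definition solution (V : Prob R Rn -> Prob R TRn) (mu0 : Prob R Rn)
    (mu : R -> Prob R Rn) :=
  measure_eq (mu 0) mu0 /\
  forall T : R, 0 < T -> forall g : Rn -> R, test_function g ->
    let F t := \int[mu t]_x g x in
    let G t := \int[V (mu t)]_p grad_dot g p in
    [/\ ae_on T (fun s => (V (mu s)).-integrable setT (EFin \o grad_dot g)),
        in_L1 T G,
        absolutely_continuous T F &
        ae_on T (fun t => is_derive t 1 F (G t))].

Definition grid (N : nat) (h : R) : set Rn :=
  [set x | forall j, (exists k : int, x 0 j = k%:~R * h) /\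
                     - N%:R <= x 0 j <= N%:R].

Definition cell (h : R) (x : Rn) : set Rn :=
  [set y | forall j, x 0 j <= y 0 j < x 0 j + h].

Definition xstep (N : nat) : R := (N%:R ^+ 2)^-1.
Definition vstep (N : nat) : R := N%:R^-1.

Definition mx_mass (N : nat) (mu : Prob R Rn) (x : Rn) : \bar R :=
  mu (cell (xstep N) x).

Definition mv_mass (N : nat) (nu : Prob R TRn) (x v : Rn) : \bar R :=
  nu ([set x] `*` cell (vstep N) v).

(* m satisfies on [0, T] the recursion defining the lattice approximation of
   parameter N. As every m t is a probability measure, this also says that the
   grids capture all the mass up to time T. *)
Definition LAS (V : Prob R Rn -> Prob R TRn) (mu0 : Prob R Rn) (N : nat)
    (T : R) (m : R -> Prob R Rn) :=
  (forall A : set (borel Rn), measurable A ->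
     m 0 A = (\sum_(x \in grid N (xstep N)) mx_mass N mu0 x * \d_(x : borel Rn) A)%E) /\
  (forall (l : nat) (t : R),
     l%:R / N%:R <= t <= l.+1%:R / N%:R -> t <= T ->
     forall A : set (borel Rn), measurable A ->
       m t A = (\sum_(x \in grid N (xstep N)) \sum_(v \in grid N (vstep N))
         mv_mass N (V (m (l%:R / N%:R)%R)) x v *
         \d_((x + (t - l%:R / N%:R) *: v)%R : borel Rn) A)%E).

(* LAS on [0, T] determines m N there up to measure_eq and restricts to smaller
   intervals, so a single family can serve all T. *)
Definition limit_of_LAS (V : Prob R Rn -> Prob R TRn) (mu0 : Prob R Rn)
    (mu : R -> Prob R Rn) :=
  exists m : nat -> R -> Prob R Rn,
    forall T : R, 0 < T ->
      (\forall N \near \oo, LAS V mu0 N T (m N)) /\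
      (fun N => ereal_sup [set WRn (m N t) (mu t) | t in `[0, T]])
        @ \oo --> 0%E.

End MeasureDifferentialEquations.

Section MeasureControls.
Context {R : realType} {n : nat} {X : metricType R} {U : set X} {u0 : U}.
Local Notation Rn := 'rV[R]_n.
Local Notation TRn := (Rn * Rn)%type.
Local Notation US := (subset_space u0).

Definition udist (u1 u2 : US) : R := mdist (subset_val u1) (subset_val u2).

(* The first condition makes u a map on Borel measures. *)
Definition measure_control (u : Prob R Rn -> Prob R (Rn * US)%type) :=
  (forall mu nu : Prob R Rn, measure_eq mu nu -> measure_eq (u mu) (u nu)) /\
  (forall mu : Prob R Rn, measure_eq (marg1 (u mu)) mu).

Definition pseudo_wasserstein (nu1 nu2 : Prob R (Rn * US)%type) : \bar R :=
  ereal_inf [set (\int[T]_p (udist p.1.2 p.2.2)%:E)%E |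
    T in [set T | coupling nu1 nu2 T /\
                  optimal_plan edist (marg1 nu1) (marg1 nu2)
                    (push (@continuous_proj13 Rn US) T)]].

Definition uniformly_pseudo_lipschitz
    (u_ : nat -> Prob R Rn -> Prob R (Rn * US)%type) :=
  exists2 C : R, 0 < C & forall (k : nat) (mu nu : Prob R Rn),
    ProbC mu -> ProbC nu ->
    (pseudo_wasserstein (u_ k mu) (u_ k nu) <= C%:E * WRn mu nu)%E.

Definition lipschitz_dynamics (f : Rn * US -> TRn) :=
  exists2 L : R, 0 < L & forall (x y : Rn) (u1 u2 : US),
    tdist (f (x, u1)) (f (y, u2)) <= L * (enorm (x - y) + udist u1 u2).

Lemma coord_le_enorm (x y : Rn) (i : 'I_n) :
  `|x 0 i - y 0 i| <= enorm (x - y).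
Proof.
rewrite /enorm -sqrtr_sqr ler_wsqrtr// (bigD1 i)//= !mxE lerDl.
by apply: sumr_ge0 => j _; exact: sqr_ge0.
Qed.

Lemma enorm_le_tdist (p q : TRn) :
  enorm (p.1 - q.1) <= tdist p q /\ enorm (p.2 - q.2) <= tdist p q.
Proof.
have e0 (z : Rn) : 0 <= enorm z by exact: sqrtr_ge0.
by split; rewrite -[leLHS]ger0_norm// -sqrtr_sqr ler_wsqrtr// (lerDl, lerDr)
  sqr_ge0.
Qed.

Lemma enorm_le_sup (x : Rn) (e : R) :
  (forall i, `|x 0 i| <= e) -> 0 <= e -> enorm x <= n%:R * e.
Proof.
move=> xe e0; rewrite /enorm -[leRHS]ger0_norm ?mulr_ge0// -sqrtr_sqr.
rewrite ler_wsqrtr// (@le_trans _ _ (\sum_(i < n) e ^+ 2))//.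
  by apply: ler_sum => i _; rewrite -real_normK ?num_real// lerXn2r ?nnegrE.
rewrite sumr_const card_ord exprMn -[leLHS]mulr_natl ler_wpM2r ?sqr_ge0//.
by rewrite -natrX ler_nat; case: (n) => // k; rewrite expnS leq_pmulr.
Qed.

Lemma lipschitz_continuous (f : Rn * US -> TRn) :
  lipschitz_dynamics f -> continuous f.
Proof.
move=> [L L0 fL] [x u]; apply/cvg_ballP => e e0.
pose d := e / (2 * L * (n%:R + 1)).
have n1 : 0 < n%:R + 1 :> R by rewrite ltr_wpDl.
have d0 : 0 < d by rewrite divr_gt0// !mulr_gt0.
have Vu : nbhs u [set v : US | udist u v < d].
  exists ((fun v : US => subset_val v) @^-1` (ball (subset_val u) d)°); split.
  - by exists (ball (subset_val u) d)°; [exact: open_interior|].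
  - by rewrite /=; exact: nbhsx_ballx.
  - by move=> v /= /interior_subset; rewrite ballEmdist.
exists (ball x d, [set v : US | udist u v < d]).
  by split => //=; exact: nbhsx_ballx.
move=> [y v] /= [[_ xy] uv].
have : tdist (f (x, u)) (f (y, v)) < e.
  apply: le_lt_trans (fL _ _ _ _) _.
  have : enorm (x - y) <= n%:R * d.
    apply: enorm_le_sup; last exact: ltW.
    by move=> i; rewrite !mxE; apply/ltW; exact: xy.
  move=> xyd; apply: (@le_lt_trans _ _ (L * (n%:R * d + d))).
    by rewrite ler_pM2l// lerD// ltW.
  rewrite -{2}[d]mul1r -mulrDl /d.
  rewrite [ltLHS](_ : _ = e / 2); first by rewrite ltr_pdivrMr// ltr_pMr// ltr1n.
  by field; rewrite ?(gt_eqF L0) ?(gt_eqF n1).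
have [h1 h2] := enorm_le_tdist (f (x, u)) (f (y, v)).
move=> fe; split; split => //= i j; rewrite ord1 /ball/=;
  apply: le_lt_trans (coord_le_enorm _ _ _) _.
- exact: le_lt_trans fe.
- exact: le_lt_trans fe.
Qed.

Definition control_field (f : Rn * US -> TRn) (hf : lipschitz_dynamics f)
    (u : Prob R Rn -> Prob R (Rn * US)%type) : Prob R Rn -> Prob R TRn :=
  fun mu => push (lipschitz_continuous hf) (u mu).

End MeasureControls.

(* Main.v *)
Require Import Defs.
From HB Require Import structures.
From mathcomp Require Import all_boot all_order all_algebra.
From mathcomp Require Import all_classical all_reals all_analysis giry.
From mathcomp Require Import measurable_realfun ring lra.

Set Implicit Arguments.
Unset Strict Implicit.
Unset Printing Implicit Defensive.

Import Order.TTheory GRing.Theory Num.Theory.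
Import numFieldNormedType.Exports.

Local Open Scope classical_set_scope.
Local Open Scope ring_scope.

(** Both [mu_ k t] and [mu t] are limits of lattice approximations as the mesh goes
    to zero, so it is enough to compare, for one large [N], the approximation driven
    by [u_ k] with the one driven by [u], with a bound that is uniform in [N].

    A lattice approximation is the explicit Euler scheme with rounding: on each
    interval of length [1 / N] it is the push-forward of the velocity field by the
    map [(x, v) |-> [x] + s [v]], where the brackets round down to the lattices
    ([LAS_lattice_step]). A plan between the controls whose projection to positions
    is optimal can be moved along by this map. Its cost grows by the factor
    [1 + s L], plus [s L] times the distance of the controls, plus rounding errors of
    order [1 / N ^ 2] ([wasserstein_lattice_step]).

    The states of the two schemes differ, and so do their controls. The two effects
    are separated by an intermediate measure, the step taken with the control [u_ k]
    from the state of the scheme driven by [u]: the Lipschitz hypothesis handles one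
    side, uniform convergence of the controls the other ([LAS_gap_step]). A discrete
    Gronwall argument over the steps up to time [t] bounds the distance of the two
    schemes by a constant times [eps + 1 / N], where [eps] bounds the distance of the
    controls ([LAS_gap]). Letting [N] and then [k] go to infinity gives the claim.

    The measure-theoretic ingredient is the triangle inequality for the Wasserstein
    distance ([wasserstein_triangle]). The intermediate measures are lattice
    measures here, so it is needed only when the middle measure is carried by a
    countable set, and the gluing of plans is then an explicit sum of normalised
    product measures ([partition_coupling]). *)

(** * Borel sets of products *)

Lemma countable_bigcup_measurable d (T : measurableType d) (I : Type)
    (D : set I) (F : I -> set T) :
  countable D -> (forall i, D i -> measurable (F i)) ->
  measurable (\bigcup_(i in D) F i).
Proof.
move=> /pfcard_geP[->|[h]] mF; first by rewrite bigcup_set0.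
rewrite (_ : \bigcup_(i in D) F i = \bigcup_k F (h k)).
  by apply: bigcupT_measurable => k; apply: mF; exact: funS.
rewrite eqEsubset; split=> [x [i Di Fix]|x [k _ Fx]].
  by have [k _ hk] := @surj _ _ _ _ h _ Di; exists k => //; rewrite hk.
by exists (h k) => //; exact: funS.
Qed.

(** With countable bases every open set of the product is a countable union of
    open rectangles, so the Borel sets of [X * Y] are generated by rectangles and
    a pair of Borel maps is Borel. This is what relates probabilities on
    [borel (X * Y)], on which couplings are defined, to product measures. *)
Lemma measurable_pair_borel d (T : measurableType d) (X Y : ptopologicalType)
    (f : T -> X) (g : T -> Y) :
  @second_countable X -> @second_countable Y ->
  measurable_fun [set: T] (f : T -> borel X) ->
  measurable_fun [set: T] (g : T -> borel Y) ->
  measurable_fun [set: T] ((fun t => (f t, g t)) : T -> borel (X * Y)%type).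
Proof.
move=> [BX cBX [oBX bX]] [BY cBY [oBY bY]] mf mg.
apply: (@measurability _ _ T (borel (X * Y)%type) setT _ (@open (X * Y)%type)) => //.
move=> _ [W oW <-]; rewrite setTI.
pose J := [set B | [/\ BX B.1, BY B.2 & B.1 `*` B.2 `<=` W]].
have cJ : countable J.
  apply: (@sub_countable _ _ _ (BX `*` BY)); last exact: countableX.
  by apply: subset_card_le => -[A B] [].
rewrite (_ : _ @^-1` W = \bigcup_(B in J) (f @^-1` B.1 `&` g @^-1` B.2)).
  apply: countable_bigcup_measurable => // -[A B] [/= BA BB _].
  apply: measurableI; rewrite -[_ @^-1` _]setTI.
  - by apply: mf => //; apply: sub_sigma_algebra; exact: oBX.
  - by apply: mg => //; apply: sub_sigma_algebra; exact: oBY.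
rewrite eqEsubset; split => [t Wt|t [[A B] [/= _ _ ABW] [Aft Bgt]]];
  last exact: ABW.
have [[A B] [/= /bX[A' [BA' A't] A'A] /bY[B' [BB' B't] B'B]] ABW] :
  nbhs (f t, g t) W by exact: open_nbhs_nbhs.
exists (A', B') => //; split => //= -[x y] [/= A'x B'y].
by apply: ABW; split; [exact: A'A|exact: B'B].
Qed.

(** The base consists of the balls with rational centre and radius [1 / k]. *)
Lemma rV_second_countable (R : realType) (n : nat) :
  @second_countable 'rV[R]_n.
Proof.
pose q (v : 'rV[rat]_n) : 'rV[R]_n := map_mx ratr v.
pose B (p : 'rV[rat]_n * nat) := (ball (q p.1) (p.2.+1%:R^-1 : R))°.
exists (range B).
  apply: (@sub_countable _ _ _ [set: 'rV[rat]_n * nat]) => //.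
  exact: card_image_le.
split=> [_ [p _ <-]|x A /nbhs_ballP[e /= e0 eA]]; first exact: open_interior.
have [//|k] := @ltr_add_invr R 0 (e / 2) _; first exact: divr_gt0.
rewrite add0r => ke.
(* centres are taken at half of the radius, so that [x] is interior to the ball *)
have k0 : 0 < k.+1%:R^-1 / 2 :> R by rewrite divr_gt0.
have /choice[v vx] (j : 'I_n) : exists r : rat, `|x 0 j - ratr r| < k.+1%:R^-1 / 2 :> R.
  have [z [/= xr [r _ rz]]] := @dense_rat R (ball (x 0 j) (k.+1%:R^-1 / 2))
    (ex_intro _ (x 0 j) (ballxx _ k0)) (ball_open _ _).
  by exists r; rewrite rz; exact: xr.
have bx : ball (q (\row_j v j)) (k.+1%:R^-1 / 2) x.
  by split=> // i j; rewrite ord1 !mxE; exact/ball_sym/vx.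
exists (B (\row_j v j, k)).
  split; first by exists (\row_j v j, k).
  apply/nbhs_ballP; exists (k.+1%:R^-1 / 2) => //= y xy.
  by rewrite [_^-1]splitr; exact: ball_triangle xy.
apply: subset_trans eA => y /interior_subset qy.
rewrite [e]splitr; apply: (@ball_triangle _ _ (q (\row_j v j))).
  apply: (@le_ball _ _ _ (k.+1%:R^-1 / 2)); last exact: ball_sym.
  rewrite ler_pM2r//; apply/ltW/(lt_trans ke).
  by rewrite ltr_pdivrMr// ltr_pMr// ltr1n.
exact: (le_ball (ltW ke)).
Qed.

Lemma measurable_pair_rV d (T : measurableType d) (R : realType) (n : nat)
    (f g : T -> 'rV[R]_n) :
  measurable_fun [set: T] (f : T -> borel 'rV[R]_n) ->
  measurable_fun [set: T] (g : T -> borel 'rV[R]_n) ->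
  measurable_fun [set: T]
    ((fun t => (f t, g t)) : T -> borel ('rV[R]_n * 'rV[R]_n)%type).
Proof. by apply: measurable_pair_borel; exact: rV_second_countable. Qed.

Lemma continuous_measurable_real (R : realType) (X : ptopologicalType)
    (f : X -> R) :
  continuous f -> measurable_fun [set: borel X] (f : borel X -> R).
Proof.
move=> /continuousP cf.
apply: (measurability _ (RGenOInfty.measurableE R)).
move=> _ [_ [a ->] <-]; rewrite setTI preimage_itvoy.
apply: sub_sigma_algebra; rewrite (_ : [set t | _] = f @^-1` [set y | a < y]).
  by apply: cf; exact: open_gt.
by apply/seteqP; split=> t /=; rewrite ?in_itv/= ?andbT.
Qed.

(** * Couplings along matching partitions *)

Lemma nneseries_measure_partition d (T : measurableType d) (R : realType)
    (m : {measure set T -> \bar R}) (A : nat -> set T) (S : set T) :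
  (forall i, measurable (A i)) -> trivIset setT A ->
  m (~` \bigcup_i A i) = 0%E -> measurable S ->
  m S = (\sum_(0 <= i <oo) m (S `&` A i))%E.
Proof.
move=> mA tA A0 mS.
have mUA : measurable (\bigcup_i A i) by exact: bigcupT_measurable.
rewrite -measure_semi_bigcup//; last 3 first.
- by move=> i; exact: measurableI.
- exact: trivIset_setIl.
- by rewrite -setI_bigcupr; exact: measurableI.
rewrite -setI_bigcupr [LHS](measureDI _ mS mUA).
rewrite (@subset_measure0 _ _ _ _ _ (~` \bigcup_i A i)) ?add0e//.
- exact: measurableD.
- exact: measurableC.
Qed.

(** This replaces the disintegration of measures in the proof of the triangle
    inequality. Two probabilities that give the same masses to the pieces of two
    countable partitions are the marginals of a probability under which both
    components fall in pieces of the same index: on [A i `*` B i] take the product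
    measure divided by the common mass of the two pieces. For pieces of mass zero the
    scaling factor is the inverse of [0], which is [0]. *)
Lemma partition_coupling d1 d2 (T1 : measurableType d1) (T2 : measurableType d2)
    (R : realType) (P1 : probability T1 R) (P2 : probability T2 R)
    (A : nat -> set T1) (B : nat -> set T2) :
  (forall i, measurable (A i)) -> (forall i, measurable (B i)) ->
  trivIset setT A -> trivIset setT B ->
  (forall i, P1 (A i) = P2 (B i)) ->
  P1 (~` \bigcup_i A i) = 0%E ->
  exists M : probability (T1 * T2)%type R,
    [/\ forall S, measurable S -> M (S `*` setT) = P1 S,
        forall S, measurable S -> M (setT `*` S) = P2 S &
        M (~` \bigcup_i (A i `*` B i)) = 0%E].
Proof.
move=> mA mB tA tB AB A0.
have mE i : measurable (A i `*` B i) by exact: measurableX.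
have mUA : measurable (\bigcup_i A i) by exact: bigcupT_measurable.
have mUB : measurable (\bigcup_i B i) by exact: bigcupT_measurable.
have mUE : measurable (\bigcup_i (A i `*` B i)) by exact: bigcupT_measurable.
have fA i : P1 (A i) \is a fin_num by exact: fin_num_measure.
have UA : P1 (\bigcup_i A i) = 1%E.
  by have := probability_setC P1 (measurableC mUA); rewrite setCK A0 sube0.
have UB : P2 (\bigcup_i B i) = 1%E.
  rewrite measure_semi_bigcup// -UA measure_semi_bigcup//.
  by apply: eq_eseriesr => i _; exact/esym/AB.
have B0 : P2 (~` \bigcup_i B i) = 0%E by rewrite probability_setC// UB subee.
have c0 i : 0 <= (fine (P1 (A i)))^-1 by rewrite invr_ge0 fine_ge0.
pose m i : {measure set (T1 * T2) -> \bar R} :=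
  mscale (NngNum (c0 i)) (mrestr (P1 \x P2)%E (mE i)).
(* only rectangles have to be measured: this gives the marginals *)
have mX i S1 S2 : measurable S1 -> measurable S2 -> m i (S1 `*` S2) =
    ((fine (P1 (A i)))^-1%:E * (P1 (S1 `&` A i) * P2 (S2 `&` B i)))%E.
  move=> mS1 mS2; rewrite /m /= /mscale /= /mrestr.
  by rewrite -setXI product_measure1E//; exact: measurableI.
have cancel i (x : \bar R) : (0 <= x)%E -> (x <= P1 (A i))%E ->
    ((fine (P1 (A i)))^-1%:E * (x * P1 (A i)) = x)%E.
  move=> x0 xA; have [c|c] := eqVneq (fine (P1 (A i))) 0.
    move: xA; rewrite -(fineK (fA i)) c => xA; rewrite !mule0.
    by apply/eqP; rewrite eq_le x0 xA.
  by rewrite muleCA -{2}(fineK (fA i)) -EFinM mulVf// mule1.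
pose M := mseries m 0.
have M1 S : measurable S -> M (S `*` setT) = P1 S.
  move=> mS; rewrite /M /mseries (nneseries_measure_partition mA)//.
  apply: eq_eseriesr => i _; rewrite mX// setTI -AB cancel//.
  by rewrite le_measure// ?inE//; exact: measurableI.
have M2 S : measurable S -> M (setT `*` S) = P2 S.
  move=> mS; rewrite /M /mseries (nneseries_measure_partition mB)//.
  apply: eq_eseriesr => i _; rewrite mX// setTI (muleC (P1 _)) cancel//.
  by rewrite AB le_measure// ?inE//; exact: measurableI.
have MT : M setT = 1%E by rewrite -setXTT M1// probability_setT.
pose Mp : probability (T1 * T2)%type R :=
  HB.pack_for (probability (T1 * T2)%type R) M
    (Measure_isProbability.Build _ _ _ M MT).
exists Mp; split => //=.
rewrite /M /mseries eseries0// => i _ _; rewrite /m /= /mscale /= /mrestr.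
rewrite (_ : _ `&` _ = set0) ?measure0 ?mule0//.
by rewrite -subset0 => q [qE ABq]; apply: qE; exists i.
Qed.

(** * The Wasserstein distance *)

(** Push-forwards along maps that are Borel but not continuous are needed because
    rounding to a lattice is not continuous. *)
Definition mpush d1 d2 (T1 : measurableType d1) (T2 : measurableType d2)
    (R : realType) (f : T1 -> T2) (mf : measurable_fun [set: T1] f)
    (P : probability T1 R) : probability T2 R :=
  distribution P (mfun_Sub (mem_set mf)).

Lemma mpushE d1 d2 (T1 : measurableType d1) (T2 : measurableType d2)
    (R : realType) (f : T1 -> T2) (mf : measurable_fun [set: T1] f)
    (P : probability T1 R) (A : set T2) : mpush mf P A = P (f @^-1` A).
Proof. by []. Qed.

Lemma ge0_integral_mpush d1 d2 (T1 : measurableType d1) (T2 : measurableType d2)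
    (R : realType) (f : T1 -> T2) (mf : measurable_fun [set: T1] f)
    (P : probability T1 R) (h : T2 -> \bar R) :
  measurable_fun [set: T2] h -> (forall y, 0 <= h y)%E ->
  (\int[mpush mf P]_y h y = \int[P]_x h (f x))%E.
Proof. by move=> mh h0; rewrite ge0_integral_distribution. Qed.

Section Wasserstein.
Context {R : realType} {X : ptopologicalType}.
Variable dist : X -> X -> R.
Hypothesis dist_ge0 : forall x y, 0 <= dist x y.
Hypothesis mdist : measurable_fun [set: borel (X * X)%type]
  ((fun p => dist p.1 p.2) : borel (X * X)%type -> R).
Implicit Types mu : Prob R X.

Lemma measurable_fst_borel (Y Z : ptopologicalType) :
  measurable_fun [set: borel (Y * Z)%type]
    ((@fst Y Z) : borel (Y * Z)%type -> borel Y).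
Proof. by apply: continuous_measurable_borel; exact: continuous_fst. Qed.

Lemma measurable_snd_borel (Y Z : ptopologicalType) :
  measurable_fun [set: borel (Y * Z)%type]
    ((@snd Y Z) : borel (Y * Z)%type -> borel Z).
Proof. by apply: continuous_measurable_borel; exact: continuous_snd. Qed.

Lemma cost_ge0 (tau : Prob R (X * X)%type) : (0 <= cost dist tau)%E.
Proof. by apply: integral_ge0 => p _; rewrite lee_fin. Qed.

Lemma wasserstein_ge0 mu1 mu2 : (0 <= wasserstein dist mu1 mu2)%E.
Proof. by apply/ereal_infP => _ [tau _ <-]; exact: cost_ge0. Qed.

Lemma wasserstein_le_cost mu1 mu2 tau :
  coupling mu1 mu2 tau -> (wasserstein dist mu1 mu2 <= cost dist tau)%E.
Proof. by move=> h; apply: ereal_inf_lbound; exists tau. Qed.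

(** Every pair of random variables with the right laws, on any probability space,
    is a coupling. All upper bounds on [wasserstein] below come from here. *)
Lemma wasserstein_le_integral d (T : measurableType d) (P : probability T R)
    (f g : T -> X) mu1 mu2
    (mf : measurable_fun [set: T] (f : T -> borel X))
    (mg : measurable_fun [set: T] (g : T -> borel X)) :
  measurable_fun [set: T] ((fun t => (f t, g t)) : T -> borel (X * X)%type) ->
  (forall A : set (borel X), measurable A -> P (f @^-1` A) = mu1 A) ->
  (forall A : set (borel X), measurable A -> P (g @^-1` A) = mu2 A) ->
  (wasserstein dist mu1 mu2 <= \int[P]_t (dist (f t) (g t))%:E)%E.
Proof.
move=> mfg f1 g2; pose tau : Prob R (X * X)%type := mpush mfg P.
rewrite (_ : (\int[P]_t _)%E = cost dist tau).
  by apply: wasserstein_le_cost; split => A mA; [exact: f1|exact: g2].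
apply/esym/(@ge0_integral_mpush _ _ _ _ _ _ mfg P (fun p => (dist p.1 p.2)%:E)).
  by apply/measurable_EFinP.
by move=> p; rewrite lee_fin.
Qed.

Lemma wasserstein_eq0 mu1 mu2 : (forall x, dist x x = 0) ->
  measure_eq mu1 mu2 -> wasserstein dist mu1 mu2 = 0%E.
Proof.
move=> dxx mu12; apply/eqP; rewrite eq_le wasserstein_ge0 andbT.
have cdiag : continuous (fun x : X => (x, x)).
  by move=> x; apply: cvg_pair; exact: cvg_id.
have := @wasserstein_le_integral _ (borel X) mu1 id id mu1 mu2
  (@measurable_id _ _ _) (@measurable_id _ _ _)
  (continuous_measurable_borel cdiag) (fun _ _ => erefl) mu12.
by rewrite (eq_integral (cst 0%E)) ?integral0// => x _; rewrite dxx.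
Qed.

Lemma wasserstein_sym mu1 mu2 : (forall x y, dist x y = dist y x) ->
  (wasserstein dist mu1 mu2 = wasserstein dist mu2 mu1)%E.
Proof.
move=> dC; wlog suff : mu1 mu2 /
    (wasserstein dist mu1 mu2 <= wasserstein dist mu2 mu1)%E.
  by move=> h; apply/eqP; rewrite eq_le !h.
apply/ereal_infP => _ [tau [tau1 tau2] <-].
have cswap : continuous (fun p : X * X => (p.2, p.1)).
  by move=> p; apply: cvg_pair; [exact: cvg_snd|exact: cvg_fst].
have := @wasserstein_le_integral _ (borel (X * X)%type) tau snd fst mu1 mu2
  (@measurable_snd_borel _ _) (@measurable_fst_borel _ _)
  (continuous_measurable_borel cswap) tau2 tau1.
rewrite /cost; under eq_integral do rewrite dC; exact.
Qed.

(** Gluing two plans along a common marginal [mu2] in general requires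
    disintegration. When [mu2] lives on a countable set [D], it is enough to cut
    both plans along the points of [D] and to apply [partition_coupling]; all the
    intermediate measures of this development are of that kind. *)
Lemma wasserstein_triangle mu1 mu2 mu3 (D : set X) :
  @second_countable X -> (forall x : X, closed [set x]) ->
  (forall x y z, dist x z <= dist x y + dist y z) ->
  countable D -> mu2 (~` D) = 0%E ->
  (wasserstein dist mu1 mu3 <=
   wasserstein dist mu1 mu2 + wasserstein dist mu2 mu3)%E.
Proof.
move=> cX c1 tri cD D0.
suff H tau1 tau2 : coupling mu1 mu2 tau1 -> coupling mu2 mu3 tau2 ->
    (wasserstein dist mu1 mu3 <= cost dist tau1 + cost dist tau2)%E.
  have [->|W12] := eqVneq (wasserstein dist mu1 mu2) +oo%E.
    by rewrite addye ?leey// gt_eqF// (lt_le_trans _ (wasserstein_ge0 _ _)).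
  have [->|W23] := eqVneq (wasserstein dist mu2 mu3) +oo%E.
    by rewrite addey ?leey// gt_eqF// (lt_le_trans _ (wasserstein_ge0 _ _)).
  have f12 : wasserstein dist mu1 mu2 \is a fin_num.
    by rewrite ge0_fin_numE ?wasserstein_ge0// ltey.
  have f23 : wasserstein dist mu2 mu3 \is a fin_num.
    by rewrite ge0_fin_numE ?wasserstein_ge0// ltey.
  apply/lee_addgt0Pr => e e0; have e20 : 0 < e / 2 by rewrite divr_gt0.
  have [_ [tau1 c12 <-] t1] := lb_ereal_inf_adherent e20 f12.
  have [_ [tau2 c23 <-] t2] := lb_ereal_inf_adherent e20 f23.
  apply: (le_trans (H _ _ c12 c23)).
  rewrite [e]splitr EFinD [X in (_ <= X)%E]addeACA.
  by apply: leeD; exact: ltW.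
move=> [t11 t12] [t21 t22].
have /countable_injP[k kinj] := cD.
pose D_ i := D `&` k @^-1` [set i].
(* each [D_ i] is a point of [D] or empty *)
have D_1 i x y : D_ i x -> D_ i y -> x = y.
  by move=> [Dx kx] [Dy ky]; apply: kinj; rewrite ?inE// kx ky.
have mD_ i : measurable (D_ i : set (borel X)).
  have [->|/set0P[x Dx]] := eqVneq (D_ i) set0; first exact: measurable0.
  rewrite (_ : D_ i = [set x]); last first.
    by apply/seteqP; split=> [y Dy|_ ->//]; exact: D_1 Dy Dx.
  rewrite -(setCK [set x]); apply: (@measurableC _ (borel X)).
  by apply: sub_sigma_algebra; exact/closed_openC.
have UD : \bigcup_i D_ i = D.
  by apply/seteqP; split=> [x [i _ []//]|x Dx]; exists (k x).
have tD : trivIset setT D_.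
  apply/trivIsetP => i j _ _ ij; rewrite -subset0 => x [[_ kx] [_ ky]].
  by move/eqP: ij; apply; rewrite -kx -ky.
have tpre (h : X * X -> X) : trivIset setT (fun i => h @^-1` D_ i).
  by move=> i j _ _ [p [Di Dj]]; apply: (tD i j) => //; exists (h p).
have mf := @measurable_fst_borel X X; have ms := @measurable_snd_borel X X.
have [||||||M [M1 M2 M3]] := @partition_coupling _ _ (borel (X * X)%type)
  (borel (X * X)%type) R tau1 tau2
  (fun i => snd @^-1` D_ i) (fun i => fst @^-1` D_ i).
- by move=> i; rewrite -[_ @^-1` _]setTI; exact: ms.
- by move=> i; rewrite -[_ @^-1` _]setTI; exact: mf.
- exact: tpre.
- exact: tpre.
- by move=> i; rewrite -[LHS]/(marg2 tau1 (D_ i)) t12// -t21.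
- rewrite -preimage_bigcup UD preimage_setC.
  rewrite -[LHS]/(marg2 tau1 (~` D)) t12// -UD.
  by apply: measurableC; exact: bigcupT_measurable.
pose T := (borel (X * X)%type * borel (X * X)%type)%type.
have mf1 : measurable_fun [set: T] ((fun q => q.1.1) : T -> borel X).
  exact: measurableT_comp mf measurable_fst.
have ms1 : measurable_fun [set: T] ((fun q => q.2.2) : T -> borel X).
  exact: measurableT_comp ms measurable_snd.
have m11 : measurable_fun [set: T]
    ((fun q => (q.1.1, q.2.2)) : T -> borel (X * X)%type).
  exact: measurable_pair_borel.
apply: le_trans (@wasserstein_le_integral _ T M (fun q => q.1.1) (fun q => q.2.2)
  mu1 mu3 mf1 ms1 _ _ _) _.
- exact: m11.
- move=> A mA; rewrite -t11// -[RHS]/(tau1 (fst @^-1` A)) -M1//.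
    by congr (M _); apply/seteqP; split=> [q Aq|q []].
  by rewrite -[_ @^-1` _]setTI; exact: mf.
- move=> A mA; rewrite -t22// -[RHS]/(tau2 (snd @^-1` A)) -M2//.
    by congr (M _); apply/seteqP; split=> [q Aq|q []].
  by rewrite -[_ @^-1` _]setTI; exact: ms.
have md := proj2 (@measurable_EFinP _ _ _ _ _) mdist.
have md1 := measurableT_comp md
  (@measurable_fst _ _ (borel (X * X)%type) (borel (X * X)%type)).
have md2 := measurableT_comp md
  (@measurable_snd _ _ (borel (X * X)%type) (borel (X * X)%type)).
rewrite (_ : cost dist tau1 = \int[M]_q (dist q.1.1 q.1.2)%:E)%E; last first.
  rewrite -(@ge0_integral_mpush _ _ T (borel (X * X)%type) _ _ measurable_fst M
    (fun p => (dist p.1 p.2)%:E))//.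
  - apply: eq_measure_integral => A mA _; apply: etrans (esym (M1 _ mA)) _.
    by congr (M _); apply/seteqP; split=> [q []|q].
  - by move=> p; rewrite lee_fin.
rewrite (_ : cost dist tau2 = \int[M]_q (dist q.2.1 q.2.2)%:E)%E; last first.
  rewrite -(@ge0_integral_mpush _ _ T (borel (X * X)%type) _ _ measurable_snd M
    (fun p => (dist p.1 p.2)%:E))//.
  - apply: eq_measure_integral => A mA _; apply: etrans (esym (M2 _ mA)) _.
    by congr (M _); apply/seteqP; split=> [q []|q].
  - by move=> p; rewrite lee_fin.
have md3 := measurableT_comp md m11.
have md12 := emeasurable_funD md1 md2.
rewrite -ge0_integralD; [|exact: measurableT|by move=> *; rewrite lee_fin
  |exact: md1|by move=> *; rewrite lee_fin|exact: md2].
apply: ae_ge0_le_integral; [exact: measurableT|by move=> *; rewrite lee_fin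
  |exact: md3|by move=> *; rewrite adde_ge0// lee_fin|exact: md12|].
(* the two middle points coincide outside of a null set *)
exists (~` \bigcup_i (snd @^-1` D_ i `*` fst @^-1` D_ i)); split => //.
- apply: measurableC; apply: bigcupT_measurable => i; apply: measurableX.
  + by rewrite -[_ @^-1` _]setTI; exact: ms.
  + by rewrite -[_ @^-1` _]setTI; exact: mf.
apply: subsetC => q [i _ [/= Di1 Di2]] _; rewrite -EFinD lee_fin.
by rewrite (le_trans (tri _ q.1.2 _))// lerD2l (D_1 _ _ _ Di1 Di2).
Qed.

End Wasserstein.

(** * The Euclidean norm and distance *)

Section EuclideanNorm.
Context {R : realType} {n : nat}.
Local Notation Rn := 'rV[R]_n.

Lemma enorm_ge0 (x : Rn) : 0 <= enorm x.
Proof. exact: sqrtr_ge0. Qed.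

Lemma sum_sqr_ge0 (x : Rn) : 0 <= \sum_j x 0 j ^+ 2.
Proof. by apply: sumr_ge0 => j _; exact: sqr_ge0. Qed.

Lemma enormN (x : Rn) : enorm (- x) = enorm x.
Proof. by rewrite /enorm; under eq_bigr do rewrite mxE sqrrN. Qed.

Lemma enorm0 : enorm (0 : Rn) = 0.
Proof. by rewrite /enorm big1 ?sqrtr0// => j _; rewrite mxE expr0n. Qed.

Lemma enormZ (s : R) (x : Rn) : 0 <= s -> enorm (s *: x) = s * enorm x.
Proof.
move=> s0; rewrite /enorm; under eq_bigr do rewrite mxE exprMn.
by rewrite -mulr_sumr sqrtrM ?sqr_ge0// sqrtr_sqr ger0_norm.
Qed.

Lemma enorm_eq0 (x : Rn) : enorm x = 0 -> x = 0.
Proof.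
move=> x0; apply/rowP => j; rewrite mxE; apply/eqP; rewrite -normr_le0 -x0.
by have := coord_le_enorm x 0 j; rewrite mxE !subr0.
Qed.

(** Expand the square of the norm of [enorm y *: x - enorm x *: y]. *)
Lemma enorm_cauchy_schwarz (x y : Rn) :
  \sum_j x 0 j * y 0 j <= enorm x * enorm y.
Proof.
have [x0|x0] := eqVneq (enorm x) 0.
  by rewrite x0 mul0r (enorm_eq0 x0) big1// => j _; rewrite mxE mul0r.
have [y0|y0] := eqVneq (enorm y) 0.
  by rewrite y0 mulr0 (enorm_eq0 y0) big1// => j _; rewrite mxE mulr0.
have p0 : 0 < 2 * (enorm x * enorm y).
  by rewrite !mulr_gt0// lt_def enorm_ge0 ?x0 ?y0.
have := sum_sqr_ge0 (enorm y *: x - enorm x *: y).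
rewrite (_ : \sum_j _ = 2 * (enorm x * enorm y) *
    (enorm x * enorm y - \sum_j x 0 j * y 0 j)).
  by rewrite pmulr_rge0// subr_ge0.
have ex : \sum_j x 0 j ^+ 2 = enorm x ^+ 2 by rewrite sqr_sqrtr// sum_sqr_ge0.
have ey : \sum_j y 0 j ^+ 2 = enorm y ^+ 2 by rewrite sqr_sqrtr// sum_sqr_ge0.
transitivity (enorm y ^+ 2 * (\sum_j x 0 j ^+ 2) + enorm x ^+ 2 * (\sum_j y 0 j ^+ 2)
  - 2 * (enorm x * enorm y) * \sum_j x 0 j * y 0 j); last by rewrite ex ey; ring.
rewrite !mulr_sumr -sumrN -!big_split/=; apply: eq_bigr => j _.
by rewrite !mxE; ring.
Qed.

Lemma enorm_triangle (x y : Rn) : enorm (x + y) <= enorm x + enorm y.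
Proof.
rewrite -[leRHS]ger0_norm ?addr_ge0 ?enorm_ge0// -sqrtr_sqr ler_wsqrtr//.
have -> : \sum_j (x + y) 0 j ^+ 2 = \sum_j x 0 j ^+ 2 + \sum_j y 0 j ^+ 2 +
    2 * \sum_j x 0 j * y 0 j.
  by rewrite mulr_sumr -!big_split/=; apply: eq_bigr => j _; rewrite !mxE; ring.
have -> : \sum_j x 0 j ^+ 2 = enorm x ^+ 2 by rewrite sqr_sqrtr// sum_sqr_ge0.
have -> : \sum_j y 0 j ^+ 2 = enorm y ^+ 2 by rewrite sqr_sqrtr// sum_sqr_ge0.
have := enorm_cauchy_schwarz x y; nra.
Qed.

Lemma euclid_dist_ge0 (x y : Rn) : 0 <= Defs.edist x y.
Proof. exact: enorm_ge0. Qed.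

Lemma euclid_distxx (x : Rn) : Defs.edist x x = 0.
Proof. by rewrite /Defs.edist subrr enorm0. Qed.

Lemma euclid_distC (x y : Rn) : Defs.edist x y = Defs.edist y x.
Proof. by rewrite /Defs.edist -enormN opprB. Qed.

Lemma euclid_dist_triangle (x y z : Rn) : Defs.edist x z <= Defs.edist x y + Defs.edist y z.
Proof.
by rewrite /Defs.edist (_ : x - z = (x - y) + (y - z)) ?enorm_triangle// addrA subrK.
Qed.

Lemma measurable_coord (j : 'I_n) :
  measurable_fun [set: borel Rn] ((fun x => x 0 j) : borel Rn -> R).
Proof. by apply: continuous_measurable_real; exact: coord_continuous. Qed.

Lemma measurable_edist d (T : measurableType d) (f g : T -> Rn) :
  measurable_fun [set: T] (f : T -> borel Rn) ->
  measurable_fun [set: T] (g : T -> borel Rn) ->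
  measurable_fun [set: T] (fun t => Defs.edist (f t) (g t)).
Proof.
move=> mf mg; apply: (@measurableT_comp _ _ _ _ _ _ (@Num.sqrt R)).
  by apply: continuous_measurable_fun => x; exact: sqrt_continuous.
apply: measurable_sum => j; apply: measurable_funX.
under eq_fun do rewrite !mxE.
apply: measurable_funB.
- exact: measurableT_comp (measurable_coord j) mf.
- exact: measurableT_comp (measurable_coord j) mg.
Qed.

Lemma closed_row1 (x : Rn) : closed [set x].
Proof. by apply: accessible_closed_set1; exact/hausdorff_accessible/norm_hausdorff. Qed.

End EuclideanNorm.

(** * Rounding to a lattice *)

Section Lattice.
Context {R : realType} {n : nat}.
Local Notation Rn := 'rV[R]_n.
Local Notation TRn := (Rn * Rn)%type.

(** Rounding down to the lattice of mesh [h]; it is split into the integer index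
    of a cell and the corner of that cell so that the countable type of indices is
    available for measurability and for countability of the range. *)
Definition lattice_index (h : R) (x : Rn) : 'rV[int]_n :=
  \row_j Num.floor (x 0 j / h).

Definition lattice_point (h : R) (k : 'rV[int]_n) : Rn :=
  \row_j ((k 0 j)%:~R * h).

Lemma cell_lattice_point (h : R) (k : 'rV[int]_n) : 0 < h ->
  cell h (lattice_point h k) = lattice_index h @^-1` [set k].
Proof.
move=> h0; apply/seteqP; split=> [y yk|y /= <- j]; last first.
  rewrite !mxE -ler_pdivlMr// floor_le/=.
  by rewrite -[X in _ + X]mul1r -mulrDl -ltr_pdivrMr// -intrD1 floorD1_gt.
apply/rowP => j; rewrite !mxE; apply/eqP; rewrite floor_eq.
have := yk j; rewrite !mxE -ler_pdivlMr// => /andP[-> /=].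
by rewrite -[X in _ + X]mul1r -mulrDl -ltr_pdivrMr// intrD.
Qed.

Lemma lattice_point_dist (h : R) (x : Rn) : 0 < h ->
  enorm (x - lattice_point h (lattice_index h x)) <= n%:R * h.
Proof.
move=> h0; apply: enorm_le_sup; last exact: ltW.
have := cell_lattice_point (lattice_index h x) h0.
move=> /(congr1 (@^~ x)) /= E.
have {E} : cell h (lattice_point h (lattice_index h x)) x by rewrite E.
move=> xk j; have := xk j; rewrite !mxE => /andP[a b].
by rewrite ger0_norm ?subr_ge0// lerBlDl ltW.
Qed.

Lemma measurable_cell (h : R) (x : Rn) : measurable (cell h x : set (borel Rn)).
Proof.
rewrite (_ : cell h x = \bigcap_(j in [set: 'I_n])
    ((fun y : Rn => y 0 j) @^-1` `[x 0 j, x 0 j + h[)).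
  apply: fin_bigcap_measurable => // j _; rewrite -[_ @^-1` _]setTI.
  by apply: measurable_coord => //; exact: measurable_itv.
apply/seteqP; split=> [y yx j _|y yx j]; first by rewrite /= in_itv; exact: yx.
by have := yx j Logic.I; rewrite /= in_itv.
Qed.

(** One Euler step of duration [s], after rounding the position to mesh [h] and
    the velocity to mesh [h']. Rounding the position leaves lattice points
    unchanged, but it makes the range of the map countable whatever measure is
    pushed forward. *)
Definition lattice_step (h h' s : R) (p : TRn) : Rn :=
  lattice_point h (lattice_index h p.1) +
  s *: lattice_point h' (lattice_index h' p.2).

Lemma measurable_setX_borel (A B : set (borel Rn)) :
  measurable A -> measurable B ->
  measurable (A `*` B : set (borel TRn)).
Proof.
move=> mA mB; rewrite (_ : A `*` B = fst @^-1` A `&` snd @^-1` B)//.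
apply: measurableI; rewrite -[_ @^-1` _]setTI.
- exact: measurable_fst_borel.
- exact: measurable_snd_borel.
Qed.

(** The map is constant on each of the countably many products of two cells. *)
Lemma measurable_lattice_step (h h' s : R) : 0 < h -> 0 < h' ->
  measurable_fun [set: borel TRn] (lattice_step h h' s : borel TRn -> borel Rn).
Proof.
move=> h0 h'0 _ A mA; rewrite setTI.
pose F (k : 'rV[int]_n * 'rV[int]_n) : Rn :=
  lattice_point h k.1 + s *: lattice_point h' k.2.
rewrite (_ : _ @^-1` A = \bigcup_(k in F @^-1` A)
    (cell h (lattice_point h k.1) `*` cell h' (lattice_point h' k.2))).
  apply: countable_bigcup_measurable => // k _.
  by apply: measurable_setX_borel; exact: measurable_cell.
apply/seteqP; split=> [p Ap|p [k Ak [/=]]].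
  exists (lattice_index h p.1, lattice_index h' p.2) => //.
  by rewrite !cell_lattice_point.
by rewrite !cell_lattice_point// /lattice_step => -> ->.
Qed.

Lemma countable_lattice_step (h h' s : R) :
  countable (range (lattice_step h h' s)).
Proof.
pose F (k : 'rV[int]_n * 'rV[int]_n) : Rn :=
  lattice_point h k.1 + s *: lattice_point h' k.2.
apply: (@sub_countable _ _ _ (range F)).
  apply: subset_card_le => _ [p _ <-].
  by exists (lattice_index h p.1, lattice_index h' p.2).
exact: (@sub_countable _ _ _ [set: 'rV[int]_n * 'rV[int]_n] (card_image_le _ _)).
Qed.

Lemma grid_lattice_point (N : nat) (h : R) (x : Rn) :
  grid N h x -> exists k, x = lattice_point h k.
Proof.
move=> gx; have /choice[k xk] j : exists k : int, x 0 j = k%:~R * h.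
  by have [] := gx j.
by exists (\row_j k j); apply/rowP => j; rewrite !mxE xk.
Qed.

(** The integer coordinates of a point of the grid are at most [N / h] in absolute
    value; they are encoded, shifted by [M], as ordinals up to [2 * M]. *)
Lemma finite_grid (N : nat) (h : R) : 0 < h -> finite_set (@grid R n N h).
Proof.
move=> h0; have [M NM] : exists M : nat, N%:R / h <= M%:R.
  exists (Num.truncn (N%:R / h)).+1; apply: ltW; exact: truncnS_gt.
pose F (k : {ffun 'I_n -> 'I_(M.*2).+1}) : Rn :=
  \row_j (((k j)%:Z - M%:Z)%:~R * h).
apply: (@sub_finite_set _ _ (range F)); last first.
  by apply: finite_image; exact: finite_finset.
move=> x gx.
have /choice[k xk] j : exists k : 'I_(M.*2).+1, x 0 j = (k%:Z - M%:Z)%:~R * h.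
  have [[k xk] /andP[Nx xN]] := gx j.
  have kM : k <= M%:Z.
    by rewrite -(@ler_int R) (le_trans _ NM)// ler_pdivlMr// -xk.
  have Mk : - M%:Z <= k.
    rewrite -(@ler_int R) -[leRHS]opprK rmorphN lerN2 (le_trans _ NM)//.
    by rewrite ler_pdivlMr// mulNr -xk lerNl.
  have kM0 : 0 <= k + M%:Z by rewrite -lerBlDr sub0r.
  have kM2 : (absz (k + M%:Z)%R < (M.*2).+1)%N.
    by rewrite ltnS -lez_nat gez0_abs// -addnn PoszD lerD2r.
  exists (Ordinal kM2); rewrite xk /=; congr (_%:~R * _).
  by rewrite gez0_abs// addrK.
by exists [ffun j => k j] => //; apply/rowP => j; rewrite mxE ffunE xk.
Qed.

End Lattice.

(** * Lattice approximations as push-forwards *)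

Section LatticeApproximation.
Context {R : realType} {n : nat}.
Local Notation Rn := 'rV[R]_n.
Local Notation TRn := (Rn * Rn)%type.

(** Apply the inequality to a set and to its complement: the total masses agree. *)
Lemma prob_eq_le d (T : measurableType d) (P1 P2 : probability T R) :
  (forall A, measurable A -> (P1 A <= P2 A)%E) -> measure_eq P1 P2.
Proof.
move=> P12 A mA; apply/eqP; rewrite eq_le P12//=.
have := P12 _ (measurableC mA).
by rewrite !probability_setC// leeD2lE// leeN2.
Qed.

Lemma xstep_gt0 (N : nat) : (0 < N)%N -> 0 < xstep N :> R.
Proof. by move=> N0; rewrite invr_gt0 exprn_gt0// ltr0n. Qed.

Lemma vstep_gt0 (N : nat) : (0 < N)%N -> 0 < vstep N :> R.
Proof. by move=> N0; rewrite invr_gt0 ltr0n. Qed.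

Lemma lattice_index_point (h : R) (k : 'rV[int]_n) : 0 < h ->
  lattice_index h (lattice_point h k) = k.
Proof.
move=> h0; have := cell_lattice_point k h0.
move=> /(congr1 (@^~ (lattice_point h k))) /= <- j.
by rewrite lexx ltrDl.
Qed.

Lemma lattice_step_phase_cell N s (x v : Rn) (p : TRn) : (0 < N)%N ->
  grid N (xstep N) x -> grid N (vstep N) v ->
  ([set x] `*` cell (vstep N) v) p ->
  lattice_step (xstep N) (vstep N) s p = x + s *: v.
Proof.
move=> N0 /grid_lattice_point[k ->] /grid_lattice_point[k' ->].
rewrite cell_lattice_point ?vstep_gt0// => -[/= px <-].
by rewrite /lattice_step px lattice_index_point ?xstep_gt0.
Qed.

Definition phase_grid (N : nat) : set TRn :=
  grid N (xstep N) `*` grid N (vstep N).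

Definition phase_cell (N : nat) (p : TRn) : set (borel TRn) :=
  [set p.1] `*` cell (vstep N) p.2.

Lemma countable_measurable_row (D : set (borel Rn)) :
  countable D -> measurable D.
Proof.
apply: countable_measurable => x; rewrite -(setCK [set x]).
apply: (@measurableC _ (borel Rn)); apply: sub_sigma_algebra.
exact/closed_openC/closed_row1.
Qed.

Lemma measurable_phase_cell N p : measurable (phase_cell N p).
Proof.
apply: measurable_setX_borel; last exact: measurable_cell.
exact: countable_measurable_row.
Qed.

Lemma trivIset_phase_cell N : (0 < N)%N -> trivIset (phase_grid N) (phase_cell N).
Proof.
move=> N0 [x v] [y w] [/= _ /grid_lattice_point[k ->]].
move=> [/= _ /grid_lattice_point[k' ->]] [q [[/= <- qv] [/= <- qw]]].
congr (_, _); move: qv qw; rewrite !cell_lattice_point ?vstep_gt0//=.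
by move=> <- ->.
Qed.

Lemma finite_phase_grid N : (0 < N)%N -> finite_set (phase_grid N).
Proof.
by move=> N0; apply: finite_setX; apply: finite_grid; rewrite ?xstep_gt0 ?vstep_gt0.
Qed.

Lemma LAS_sum V mu0 N T (m : R -> Prob R Rn) l t A : (0 < N)%N ->
  LAS V mu0 N T m ->
  l%:R / N%:R <= t <= l.+1%:R / N%:R -> t <= T ->
  measurable (A : set (borel Rn)) ->
  m t A = (\sum_(p \in phase_grid N) V (m (l%:R / N%:R)%R) (phase_cell N p) *
    \d_((p.1 + (t - l%:R / N%:R) *: p.2)%R : borel Rn) A)%E.
Proof.
move=> N0 [_ L] lt tT mA; rewrite (L l t lt tT A mA).
rewrite pair_fsbig//; apply: finite_grid; rewrite ?xstep_gt0 ?vstep_gt0//.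
Qed.

(** The lattice approximation keeps only the mass of the velocity field that lies
    over the grids, so it is at most the push-forward by [lattice_step]; being a
    probability, it is equal to it. In this form it can be compared to another
    lattice approximation by transporting one velocity field to the other. *)
Lemma LAS_lattice_step V mu0 N T (m : R -> Prob R Rn) l t
  (h0 : 0 < xstep N :> R) (h'0 : 0 < vstep N :> R) : (0 < N)%N ->
  LAS V mu0 N T m ->
  l%:R / N%:R <= t <= l.+1%:R / N%:R -> t <= T ->
  measure_eq (m t)
    (mpush (measurable_lattice_step (t - l%:R / N%:R) h0 h'0)
       (V (m (l%:R / N%:R)))).
Proof.
move=> N0 L lt tT; apply: prob_eq_le => A mA.
rewrite (LAS_sum N0 L lt tT mA) mpushE.
set s := t - _; set S := lattice_step _ _ _.
set nu : Prob R TRn := V _.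
have mSA : measurable (S @^-1` A : set (borel TRn)).
  by rewrite -[_ @^-1` _]setTI; apply: measurable_lattice_step.
pose F p := phase_cell N p `&` S @^-1` A.
have mF p : measurable (F p) by apply: measurableI => //; exact: measurable_phase_cell.
rewrite (eq_fsbigr (fun p => nu (F p))); last first.
  move=> [x v] /[!inE] -[/= gx gv]; rewrite diracE.
  have E q : phase_cell N (x, v) q -> S q = x + s *: v by exact: lattice_step_phase_cell.
  have [xA|xA] := boolP (_ \in _); rewrite ?(mule1, mule0); last first.
    rewrite (_ : F _ = set0) ?measure0// -subset0 => q [rq] /=.
    by rewrite (E _ rq) => /mem_set; rewrite (negbTE xA).
  congr (nu _); apply/seteqP; split=> [q rq|q []//]; split=> //=.
  by rewrite (E _ rq); exact/set_mem.
rewrite -measure_fin_bigcup//; first last.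
- apply: trivIset_setIr; exact: trivIset_phase_cell.
- exact: finite_phase_grid.
rewrite le_measure ?inE//.
- by apply: fin_bigcup_measurable => //; exact: finite_phase_grid.
- by apply: bigcup_sub => p _ q [].
Qed.

(** The approximations charge a finite set only, so the estimates assumed on
    compactly supported measures apply to them. *)
Lemma LAS_ProbC V mu0 N T (m : R -> Prob R Rn) l t : (0 < N)%N ->
  LAS V mu0 N T m ->
  l%:R / N%:R <= t <= l.+1%:R / N%:R -> t <= T -> ProbC (m t).
Proof.
move=> N0 L lt tT; rewrite /ProbC /=; apply: finite_compact.
pose F (p : Rn * Rn) := p.1 + (t - l%:R / N%:R) *: p.2.
apply: (@sub_finite_set _ _ (F @` phase_grid N)); last first.
  by apply: finite_image; exact: finite_phase_grid.
move=> x sx; apply: contrapT => Fx.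
have oF : open (~` (F @` phase_grid N)).
  apply: closed_openC; apply: compact_closed; first exact: norm_hausdorff.
  by apply: finite_compact; apply: finite_image; exact: finite_phase_grid.
have := sx _ oF Fx; rewrite (LAS_sum N0 L lt tT); last exact: sub_sigma_algebra.
rewrite fsbig1 ?ltxx// => p pN; rewrite diracE memNset ?mule0//=.
by apply; exists p.
Qed.

Lemma LAS_time_interval (N : nat) (t : R) : (0 < N)%N -> 0 <= t ->
  exists l : nat, l%:R / N%:R <= t <= l.+1%:R / N%:R.
Proof.
move=> N0 t0; have Npos : 0 < N%:R :> R by rewrite ltr0n.
exists (Num.truncn (t * N%:R)).
have /andP[l1 l2] : (Num.truncn (t * N%:R))%:R <= t * N%:R <
    (Num.truncn (t * N%:R)).+1%:R by rewrite truncn_itv// mulr_ge0.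
by rewrite ler_pdivrMr// l1 ler_pdivlMr// ltW.
Qed.

Lemma mpush_lattice_step_countable (s h h' : R) (h0 : 0 < h) (h'0 : 0 < h')
    (nu : Prob R TRn) :
  mpush (measurable_lattice_step s h0 h'0) nu
    (~` range (lattice_step h h' s)) = 0%E.
Proof.
rewrite mpushE (_ : _ @^-1` _ = set0) ?measure0// -subset0 => p; apply.
by exists p.
Qed.

Lemma LAS_countable V mu0 N T (m : R -> Prob R Rn) t : (0 < N)%N ->
  LAS V mu0 N T m -> 0 <= t -> t <= T ->
  exists2 D : set Rn, countable D & m t (~` D) = 0%E.
Proof.
move=> N0 L t0 tT; have [l lt] := LAS_time_interval N0 t0.
exists (range (lattice_step (xstep N) (vstep N) (t - l%:R / N%:R))).
  exact: countable_lattice_step.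
rewrite (LAS_lattice_step (xstep_gt0 N0) (vstep_gt0 N0) N0 L lt tT).
  exact: mpush_lattice_step_countable.
apply: measurableC; apply: countable_measurable_row.
exact: countable_lattice_step.
Qed.

End LatticeApproximation.

(** * Transport through one time step *)

Lemma continuous_proj24 (Y Z : topologicalType) :
  continuous (fun p : (Y * Z) * (Y * Z) => (p.1.2, p.2.2)).
Proof.
move=> p; apply: cvg_pair.
- exact: (continuous_comp (@continuous_fst _ _ p) (@continuous_snd _ _ _)).
- exact: (continuous_comp (@continuous_snd _ _ p) (@continuous_snd _ _ _)).
Qed.

Lemma ge0_integral_affine d (T : measurableType d) (R : realType)
    (P : probability T R) (g1 g2 : T -> R) (a b c : R) :
  0 <= a -> 0 <= b -> 0 <= c -> (forall t, 0 <= g1 t) -> (forall t, 0 <= g2 t) ->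
  measurable_fun [set: T] g1 -> measurable_fun [set: T] g2 ->
  (\int[P]_t (a * g1 t + b * g2 t + c)%:E =
   a%:E * \int[P]_t (g1 t)%:E + b%:E * \int[P]_t (g2 t)%:E + c%:E)%E.
Proof.
move=> a0 b0 c0 g10 g20 m1 m2.
have m1' : measurable_fun [set: T] (EFin \o g1) by exact/measurable_EFinP.
have m2' : measurable_fun [set: T] (EFin \o g2) by exact/measurable_EFinP.
under eq_integral do rewrite !EFinD !EFinM.
rewrite ge0_integralD//; last 2 first.
- by move=> t _; rewrite -!EFinM -EFinD lee_fin addr_ge0// mulr_ge0.
- by apply: emeasurable_funD; exact: measurable_funeM.
rewrite integral_cst// [X in (c%:E * X)%E](_ : _ = 1%E); last exact: probability_setT.
rewrite mule1 ge0_integralD//; last 4 first.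
- by move=> t _; rewrite -EFinM lee_fin mulr_ge0.
- exact: measurable_funeM.
- by move=> t _; rewrite -EFinM lee_fin mulr_ge0.
- exact: measurable_funeM.
by rewrite !ge0_integralZl// => t _; rewrite lee_fin.
Qed.

Section LatticeStepEstimate.
Context {R : realType} {n : nat} {X : metricType R} {U : set X} {u0 : U}.
Local Notation Rn := 'rV[R]_n.
Local Notation TRn := (Rn * Rn)%type.
Local Notation US := (subset_space u0).

Lemma nbhs_udist (v : US) (e : R) : 0 < e -> nbhs v [set w : US | udist v w < e].
Proof.
move=> e0; exists ((fun w : US => subset_val w) @^-1` (ball (subset_val v) e)°); split.
- by exists (ball (subset_val v) e)°; [exact: open_interior|].
- by rewrite /=; exact: nbhsx_ballx.
- by move=> w /= /interior_subset; rewrite ballEmdist.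
Qed.

Lemma udist_triangle (v w z : US) : udist v z <= udist v w + udist w z.
Proof. exact: metric_triangle. Qed.

Lemma udistC (v w : US) : udist v w = udist w v.
Proof. exact: metric_sym. Qed.

Lemma continuous_udist : continuous (fun p : US * US => udist p.1 p.2).
Proof.
move=> [v w]; apply/cvgrPdist_lt => e e0 /=.
have e20 : 0 < e / 2 by rewrite divr_gt0.
exists ([set z | udist v z < e / 2], [set z | udist w z < e / 2]).
  by split; exact: nbhs_udist.
move=> [v' w'] /= [vv' ww'].
have := udist_triangle v v' w; have := udist_triangle v' w' w.
have := udist_triangle v' v w'; have := udist_triangle v w w'.
rewrite (udistC v' v) (udistC w' w) => a b c d; rewrite ltr_norml; lra.
Qed.

Lemma measurable_udist : measurable_fun
  [set: borel ((Rn * US) * (Rn * US))%type]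
  ((fun p => udist p.1.2 p.2.2) : borel ((Rn * US) * (Rn * US))%type -> R).
Proof.
have c := @continuous_proj24 Rn US.
apply: continuous_measurable_real => p.
exact: (@continuous_comp _ _ _ _ (fun q : US * US => udist q.1 q.2) p (c p)
  (@continuous_udist _)).
Qed.

Lemma measurable_edist_pair : measurable_fun [set: borel TRn]
  ((fun p => Defs.edist p.1 p.2) : borel TRn -> R).
Proof.
by apply: measurable_edist; [exact: measurable_fst_borel|exact: measurable_snd_borel].
Qed.

Lemma optimal_plan_cost (mu1 mu2 : Prob R Rn) (tau : Prob R TRn) :
  optimal_plan Defs.edist mu1 mu2 tau -> (cost Defs.edist tau <= WRn mu1 mu2)%E.
Proof. by move=> [_ opt]; apply/ereal_infP => _ [tau' c <-]; exact: opt. Qed.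

Variables (f : Rn * US -> TRn) (fhat : Rn -> US -> Rn).
Hypothesis hfhat : forall x v, f (x, v) = (x, fhat x v).
Hypothesis hf : lipschitz_dynamics f.
Variable L : R.
Hypothesis L0 : 0 < L.
Hypothesis fL : forall (x y : Rn) (u1 u2 : US),
    tdist (f (x, u1)) (f (y, u2)) <= L * (enorm (x - y) + udist u1 u2).

(** The two rounding errors in position are at most [n * h] each, those in velocity
    at most [n * h'] each, and the Lipschitz bound controls the rest. *)
Lemma edist_lattice_step (h h' s : R) (p q : Rn * US) :
  0 < h -> 0 < h' -> 0 <= s ->
  Defs.edist (lattice_step h h' s (f p)) (lattice_step h h' s (f q)) <=
  (1 + s * L) * Defs.edist p.1 q.1 + s * L * udist p.2 q.2 +
  2 * n%:R * (h + s * h').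
Proof.
case: p q => [x v] [y w] h0 h'0 s0; rewrite !hfhat /lattice_step /=.
set x' := lattice_point h _; set v' := lattice_point h' _.
set y' := lattice_point h _; set w' := lattice_point h' _.
have xx : Defs.edist x' x <= n%:R * h by rewrite euclid_distC; exact: lattice_point_dist.
have yy : Defs.edist y y' <= n%:R * h by exact: lattice_point_dist.
have vv : Defs.edist v' (fhat x v) <= n%:R * h'.
  by rewrite euclid_distC; exact: lattice_point_dist.
have ww : Defs.edist (fhat y w) w' <= n%:R * h' by exact: lattice_point_dist.
have fvw : Defs.edist (fhat x v) (fhat y w) <= L * (Defs.edist x y + udist v w).
  by have := fL x y v w; rewrite !hfhat; apply: le_trans;
     exact: (proj2 (enorm_le_tdist (x, fhat x v) (y, fhat y w))).
have xy : Defs.edist x' y' <= Defs.edist x y + 2 * n%:R * h.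
  have := euclid_dist_triangle x' x y'; have := euclid_dist_triangle x y y'; lra.
have vw : Defs.edist v' w' <= L * (Defs.edist x y + udist v w) + 2 * n%:R * h'.
  have := euclid_dist_triangle v' (fhat x v) w'.
  have := euclid_dist_triangle (fhat x v) (fhat y w) w'; lra.
have : Defs.edist (x' + s *: v') (y' + s *: w') <= Defs.edist x' y' + s * Defs.edist v' w'.
  rewrite /Defs.edist -enormZ// scalerBr (_ : _ - _ = (x' - y') + (s *: v' - s *: w')).
    exact: enorm_triangle.
  by rewrite opprD addrACA.
have : s * Defs.edist v' w' <= s * (L * (Defs.edist x y + udist v w) + 2 * n%:R * h').
  exact: ler_wpM2l.
lra.
Qed.

(** Take a plan that nearly realises the pseudo-distance, whose projection to the
    positions is an optimal plan, and move both of its ends by one Euler step. The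
    same plan controls the change of position and the change of control, which is
    why the pseudo-distance is the right quantity to be assumed small. *)
Lemma wasserstein_lattice_step (nu1 nu2 : Prob R (Rn * US)%type)
    (h h' s E B : R) (h0 : 0 < h) (h'0 : 0 < h') :
  0 <= s -> (pseudo_wasserstein nu1 nu2 < B%:E)%E ->
  (WRn (marg1 nu1) (marg1 nu2) <= E%:E)%E ->
  (WRn (mpush (measurable_lattice_step s h0 h'0)
         (push (lipschitz_continuous hf) nu1))
       (mpush (measurable_lattice_step s h0 h'0)
         (push (lipschitz_continuous hf) nu2)) <=
   (E + s * L * (E + B) + 2 * n%:R * (h + s * h'))%:E)%E.
Proof.
move=> s0 /ereal_inf_lt[_ [T [[T1 T2] opt] <-] TB] WE.
set S := lattice_step h h' s.
have mS : measurable_fun [set: borel (Rn * US)%type]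
    ((S \o f) : borel (Rn * US)%type -> borel Rn).
  apply: (@measurableT_comp _ _ _ _ (borel TRn)).
    exact: measurable_lattice_step.
  by apply: continuous_measurable_borel; exact: lipschitz_continuous.
have mf := @measurable_fst_borel (Rn * US)%type (Rn * US)%type.
have ms := @measurable_snd_borel (Rn * US)%type (Rn * US)%type.
have mS1 := measurableT_comp mS mf; have mS2 := measurableT_comp mS ms.
have m1 := measurableT_comp (@measurable_fst_borel Rn US) mf.
have m2 := measurableT_comp (@measurable_fst_borel Rn US) ms.
have mS1S2 := measurable_pair_rV mS1 mS2.
apply: (@le_trans _ _ (\int[T]_p (Defs.edist (S (f p.1)) (S (f p.2)))%:E)%E).
  apply: (@wasserstein_le_integral R Rn Defs.edist euclid_dist_ge0 measurable_edist_pair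
    _ _ T _ _ _ _ mS1 mS2 mS1S2) => A mA.
  - rewrite -[RHS]/(nu1 ((S \o f) @^-1` A)) -T1//.
    by rewrite -[_ @^-1` _]setTI; exact: mS.
  - rewrite -[RHS]/(nu2 ((S \o f) @^-1` A)) -T2//.
    by rewrite -[_ @^-1` _]setTI; exact: mS.
have [sL0 c0] : 0 <= s * L /\ 0 <= 2 * n%:R * (h + s * h').
  by rewrite !(mulr_ge0, addr_ge0)// ltW.
have me : measurable_fun [set: borel ((Rn * US) * (Rn * US))%type]
  ((fun p => Defs.edist p.1.1 p.2.1) : borel ((Rn * US) * (Rn * US))%type -> R).
  exact: measurable_edist.
have mu := @measurable_udist.
apply: (@le_trans _ _ (\int[T]_p ((1 + s * L) * Defs.edist p.1.1 p.2.1 +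
    s * L * udist p.1.2 p.2.2 + 2 * n%:R * (h + s * h'))%:E)%E).
  apply: ge0_le_integral => //.
  - by move=> p _; rewrite lee_fin euclid_dist_ge0.
  - by apply/measurable_EFinP; exact: measurable_edist.
  - apply/measurable_EFinP; apply: measurable_funD => //.
    by apply: measurable_funD; exact: measurable_funM.
  - by move=> p _; rewrite lee_fin; exact: edist_lattice_step.
rewrite ge0_integral_affine ?addr_ge0//; last 2 first.
- by move=> p; exact: euclid_dist_ge0.
- by move=> p; exact: mdist_ge0.
have -> : (\int[T]_p (Defs.edist p.1.1 p.2.1)%:E)%E =
    cost Defs.edist (push (@continuous_proj13 Rn US) T).
  rewrite /cost /push ge0_integral_distribution//.
    by apply/measurable_EFinP; exact: measurable_edist_pair.
  by move=> p; rewrite lee_fin euclid_dist_ge0.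
have TE := le_trans (optimal_plan_cost opt) WE.
rewrite [X in (_ <= X)%E](_ : _ = ((1 + s * L)%:E * E%:E + (s * L)%:E * B%:E +
  (2 * n%:R * (h + s * h'))%:E)%E); last first.
  by rewrite -!EFinM -!EFinD; congr (_%:E); ring.
apply: leeD => //; apply: leeD; apply: lee_wpmul2l; rewrite ?lee_fin ?addr_ge0//.
exact: ltW.
Qed.

End LatticeStepEstimate.

(** * Comparison of two lattice approximations *)

Lemma wasserstein_measure_eq (R : realType) (X : ptopologicalType)
    (dist : X -> X -> R) (mu1 mu2 nu1 nu2 : Prob R X) :
  measure_eq mu1 nu1 -> measure_eq mu2 nu2 ->
  wasserstein dist mu1 mu2 = wasserstein dist nu1 nu2.
Proof.
move=> e1 e2; congr (ereal_inf (_ @` _)).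
apply/seteqP; split=> tau [t1 t2]; split=> A mA.
- by rewrite t1// e1.
- by rewrite t2// e2.
- by rewrite t1// e1.
- by rewrite t2// e2.
Qed.

Lemma cvge0_lt (R : realType) (f : nat -> \bar R) (e : R) :
  f @ \oo --> 0%E -> 0 < e -> \forall k \near \oo, (f k < e%:E)%E.
Proof.
move=> /fine_cvgP[ff /cvgrPdist_lt fe] e0; near=> k.
have fk : f k \is a fin_num by near: k.
rewrite -(fineK fk) lte_fin.
have : `|0 - fine (f k)| < e by near: k; exact: fe.
by rewrite sub0r normrN; exact/le_lt_trans/ler_norm.
Unshelve. all: by end_near. Qed.

Lemma cvge0_le (R : realType) (f : nat -> \bar R) : (forall k, 0 <= f k)%E ->
  (forall e : R, 0 < e -> \forall k \near \oo, (f k <= e%:E)%E) ->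
  f @ \oo --> 0%E.
Proof.
move=> f0 fe.
have ff (e : R) k : (f k <= e%:E)%E -> f k \is a fin_num.
  by move=> fk; rewrite ge0_fin_numE// (le_lt_trans fk)// ltry.
apply/fine_cvgP; split.
  by apply: filterS (fe 1 ltr01) => k; exact: ff.
apply/cvgrPdist_le => e e0; apply: filterS (fe e e0) => k fk.
rewrite sub0r normrN ger0_norm ?fine_ge0//.
by rewrite -lee_fin fineK// (ff e).
Qed.

Section LatticeComparison.
Context {R : realType} {n : nat} {X : metricType R} {U : set X} {u0 : U}.
Local Notation Rn := 'rV[R]_n.
Local Notation TRn := (Rn * Rn)%type.
Local Notation US := (subset_space u0).
Variables (f : Rn * US -> TRn) (fhat : Rn -> US -> Rn).
Hypothesis hfhat : forall x v, f (x, v) = (x, fhat x v).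
Hypothesis hf : lipschitz_dynamics f.
Variable L : R.
Hypothesis L0 : 0 < L.
Hypothesis fL : forall (x y : Rn) (u1 u2 : US),
    tdist (f (x, u1)) (f (y, u2)) <= L * (enorm (x - y) + udist u1 u2).
Variables (u1 u2 : Prob R Rn -> Prob R (Rn * US)%type).
Hypotheses (hu1 : measure_control u1) (hu2 : measure_control u2).
Variables (C eps : R).
Hypotheses (C0 : 0 < C) (eps0 : 0 < eps).
Hypothesis u1C : forall mu nu : Prob R Rn, ProbC mu -> ProbC nu ->
  (pseudo_wasserstein (u1 mu) (u1 nu) <= C%:E * WRn mu nu)%E.
Hypothesis u12 : forall mu : Prob R Rn, ProbC mu ->
  (pseudo_wasserstein (u1 mu) (u2 mu) < eps%:E)%E.
Variables (mu0 : Prob R Rn) (N : nat) (T : R) (m1 m2 : R -> Prob R Rn).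
Hypothesis N0 : (0 < N)%N.
Hypothesis las1 : LAS (control_field hf u1) mu0 N T m1.
Hypothesis las2 : LAS (control_field hf u2) mu0 N T m2.

(** The comparison of the two schemes is a discrete Gronwall inequality with rate
    [a] and with forcing [Q], the distance of the controls plus rounding errors. *)
Let a := L * (1 + C).
Let Q := 2 * L * eps + 8 * n%:R / N%:R.

Lemma WRn_marg1 (v w : Prob R Rn -> Prob R (Rn * US)%type) mu nu :
  measure_control v -> measure_control w ->
  WRn (marg1 (v mu)) (marg1 (w nu)) = WRn mu nu.
Proof. by move=> [_ hv] [_ hw]; exact: wasserstein_measure_eq. Qed.

Lemma WRn_ge0 (mu nu : Prob R Rn) : (0 <= WRn mu nu)%E.
Proof. by apply: wasserstein_ge0; exact: euclid_dist_ge0. Qed.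

Lemma WRn_triangle (mu nu pi : Prob R Rn) (D : set Rn) :
  countable D -> nu (~` D) = 0%E ->
  (WRn mu pi <= WRn mu nu + WRn nu pi)%E.
Proof.
apply: wasserstein_triangle.
- exact: euclid_dist_ge0.
- exact: measurable_edist_pair.
- exact: rV_second_countable.
- exact: closed_row1.
- exact: euclid_dist_triangle.
Qed.

(** The pseudo-distance has no triangle inequality, as a composition of optimal
    plans need not be optimal. So the triangle inequality is used for [WRn] only,
    after the step, through the measure obtained by applying the control [u1] at
    the state of the second scheme. The first half compares two states under the
    same control, which is the Lipschitz hypothesis; the second half compares two
    controls at the same state, where the positions do not move. *)
Lemma LAS_gap_step (l : nat) (t E : R) :
  l%:R / N%:R <= t <= l.+1%:R / N%:R -> t <= T ->
  (WRn (m1 (l%:R / N%:R)) (m2 (l%:R / N%:R)) <= E%:E)%E ->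
  (WRn (m1 t) (m2 t) <= (E + (a * E + Q) / N%:R)%:E)%E.
Proof.
move=> lt tT WE; set t0 : R := l%:R / N%:R in lt WE *.
have Npos : 0 < N%:R :> R by rewrite ltr0n.
have /andP[lt0 lt1] := lt.
have lT : t0 <= T by exact: le_trans tT.
have ll : t0 <= t0 <= l.+1%:R / N%:R by rewrite lexx (le_trans lt0 lt1).
have E0 : 0 <= E by rewrite -lee_fin (le_trans (WRn_ge0 _ _) WE).
have c1 := LAS_ProbC N0 las1 ll lT; have c2 := LAS_ProbC N0 las2 ll lT.
set s := t - t0.
have s0 : 0 <= s by rewrite subr_ge0.
have s1 : s <= N%:R^-1.
  by rewrite lerBlDl (le_trans lt1)// /t0 -addn1 natrD mulrDl mul1r.
have h0 : 0 < xstep N :> R by exact: xstep_gt0.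
have h'0 : 0 < vstep N :> R by exact: vstep_gt0.
rewrite /WRn (wasserstein_measure_eq _ (LAS_lattice_step h0 h'0 N0 las1 lt tT)
  (LAS_lattice_step h0 h'0 N0 las2 lt tT)).
rewrite -/t0 -/s /control_field.
have p1 : (pseudo_wasserstein (u1 (m1 t0)) (u1 (m2 t0)) < (C * E + eps)%:E)%E.
  rewrite (le_lt_trans (u1C c1 c2))// (@le_lt_trans _ _ (C * E)%:E)//.
    by rewrite EFinM lee_wpmul2l// lee_fin ltW.
  by rewrite lte_fin ltrDl.
have w1 : (WRn (marg1 (u1 (m1 t0))) (marg1 (u1 (m2 t0))) <= E%:E)%E.
  by rewrite WRn_marg1.
have w2 : (WRn (marg1 (u1 (m2 t0))) (marg1 (u2 (m2 t0))) <= 0%:E)%E.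
  by rewrite WRn_marg1// [WRn _ _]wasserstein_eq0//; [exact: euclid_dist_ge0
    |exact: measurable_edist_pair|exact: euclid_distxx].
have S1 := wasserstein_lattice_step hfhat hf L0 fL h0 h'0 s0 p1 w1.
have S2 := wasserstein_lattice_step hfhat hf L0 fL h0 h'0 s0 (u12 c2) w2.
apply: le_trans (WRn_triangle _ _ (countable_lattice_step _ _ _)
  (mpush_lattice_step_countable s h0 h'0
    (push (lipschitz_continuous hf) (u1 (m2 t0))))) _.
apply: (le_trans (leeD S1 S2)); rewrite -EFinD lee_fin.
rewrite /xstep /vstep -exprVn.
set i : R := N%:R^-1 in s1 *.
have i0 : 0 <= i by rewrite invr_ge0 ltW.
have hs : 2 * n%:R * (i ^+ 2 + s * i) <= 4 * n%:R * i ^+ 2.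
  have : s * i <= i * i by exact: ler_wpM2r.
  have : 0 <= n%:R :> R by [].
  move=> n0 si; have : n%:R * (s * i) <= n%:R * (i * i) by exact: ler_wpM2l.
  lra.
have sa : s * (L * (E + (C * E + eps)) + L * eps) <=
    i * (L * (E + (C * E + eps)) + L * eps).
  by apply: ler_wpM2r => //; rewrite !(addr_ge0, mulr_ge0)// ltW.
rewrite /a /Q -/i; lra.
Qed.

(** Induction on the time steps with [1 + a / N <= expR (a / N)]. The bound is
    written for [t + 1] because the step containing [t] may end after [t]. *)
Lemma LAS_gap (t : R) : 0 <= t -> t <= T ->
  (WRn (m1 t) (m2 t) <= (expR (a * (t + 1)) * (t + 1) * Q)%:E)%E.
Proof.
move=> t0 tT.
have Npos : 0 < N%:R :> R by rewrite ltr0n.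
have a0 : 0 <= a by rewrite mulr_ge0 ?addr_ge0// ltW.
have Q0 : 0 <= Q by rewrite !(addr_ge0, mulr_ge0, invr_ge0)// ltW.
have step (l : nat) : (expR (a * (l%:R / N%:R)) * (l%:R / N%:R) * Q +
    (a * (expR (a * (l%:R / N%:R)) * (l%:R / N%:R) * Q) + Q) / N%:R <=
    expR (a * (l.+1%:R / N%:R)) * (l.+1%:R / N%:R) * Q)%R.
  rewrite (_ : l.+1%:R / N%:R = l%:R / N%:R + N%:R^-1); last first.
    by rewrite -addn1 natrD mulrDl mul1r.
  rewrite [a * (_ + _)]mulrDr expRD.
  set x := expR (a * (l%:R / N%:R)); set y := expR _; set z : R := l%:R / N%:R.
  set i : R := N%:R^-1.
  have i0 : 0 <= i by rewrite invr_ge0 ltW.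
  have z0 : 0 <= z by rewrite mulr_ge0// invr_ge0 ltW.
  have x1 : 1 <= x.
    by rewrite -[X in X <= _]expR0 /x ler_expR mulr_ge0// mulr_ge0// invr_ge0 ltW.
  have yi : 1 + a * i <= y by exact: expR_ge1Dx.
  have y1 : 1 <= y by rewrite (le_trans _ yi)// lerDl mulr_ge0.
  have A1 : x * z * Q * (1 + a * i) <= x * z * Q * y.
    by rewrite ler_wpM2l// !mulr_ge0// (le_trans _ x1).
  have A2 : i * Q * 1 <= i * Q * (x * y).
    by rewrite ler_wpM2l ?mulr_ge0// mulr_ege1.
  lra.
have iter (l : nat) : l%:R / N%:R <= T ->
    (WRn (m1 (l%:R / N%:R)) (m2 (l%:R / N%:R)) <=
     (expR (a * (l%:R / N%:R)) * (l%:R / N%:R) * Q)%:E)%E.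
  elim: l => [_|l IH lT].
    rewrite !mul0r mulr0 mul0r [WRn _ _]wasserstein_eq0//.
    - exact: euclid_dist_ge0.
    - exact: measurable_edist_pair.
    - exact: euclid_distxx.
    - move=> A mA; exact: (etrans (proj1 las1 _ mA) (esym (proj1 las2 _ mA))).
  have ll : l%:R / N%:R <= l.+1%:R / N%:R :> R.
    by rewrite ler_pM2r ?invr_gt0// ler_nat.
  have ll' : (l%:R / N%:R <= l.+1%:R / N%:R :> R) &&
      (l.+1%:R / N%:R <= l.+1%:R / N%:R :> R).
    by rewrite ll lexx.
  apply: (le_trans (LAS_gap_step ll' lT (IH (le_trans ll lT)))).
  by rewrite lee_fin.
have [l lt] := LAS_time_interval N0 t0.
apply: (le_trans (LAS_gap_step lt tT (iter _ (le_trans (proj1 (andP lt)) tT)))).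
rewrite lee_fin (le_trans (step _))// ler_wpM2r//.
have lt1 : l.+1%:R / N%:R <= t + 1.
  rewrite -addn1 natrD mulrDl mul1r lerD// ?(proj1 (andP lt))//.
  by rewrite invf_le1// ler1n.
by rewrite ler_pM ?expR_ge0// ?ler_expR ?ler_wpM2l// mulr_ge0.
Qed.

End LatticeComparison.

(** * Convergence of the solutions *)

Theorem theorem6 (R : realType) (n : nat)
    (X : metricType R) (hX : polish X)
    (U : set X) (hU : compact U) (u0 : U)
    (f : 'rV[R]_n * subset_space u0 -> 'rV[R]_n * 'rV[R]_n)
    (fhat : 'rV[R]_n -> subset_space u0 -> 'rV[R]_n)
    (hfhat : forall x v, f (x, v) = (x, fhat x v))
    (hf : lipschitz_dynamics f)
    (mu0 : Prob R 'rV[R]_n) (hmu0 : ProbC mu0)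
    (u_ : nat -> Prob R 'rV[R]_n -> Prob R ('rV[R]_n * subset_space u0)%type)
    (hu_ : forall k, measure_control (u_ k))
    (hu_lip : uniformly_pseudo_lipschitz u_)
    (u : Prob R 'rV[R]_n -> Prob R ('rV[R]_n * subset_space u0)%type)
    (hu : measure_control u)
    (hu_lim : (fun k => ereal_sup [set pseudo_wasserstein (u_ k mu) (u mu)
                                  | mu in @ProbC R 'rV[R]_n])
                @ \oo --> 0%E)
    (mu_ : nat -> R -> Prob R 'rV[R]_n)
    (hmu_ : forall k, solution (control_field hf (u_ k)) mu0 (mu_ k) /\
                      limit_of_LAS (control_field hf (u_ k)) mu0 (mu_ k))
    (mu : R -> Prob R 'rV[R]_n)
    (hmu : solution (control_field hf u) mu0 mu /\
           limit_of_LAS (control_field hf u) mu0 mu) :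
  forall t : R, 0 <= t -> (fun k => WRn (mu_ k t) (mu t)) @ \oo --> 0%E.
Proof.
move=> t t0.
have [L L0 fL] := hf; have [C C0 uC] := hu_lip.
apply: cvge0_le => [k|e e0]; first exact: WRn_ge0.
have T0 : 0 < t + 1 by rewrite ltr_wpDl.
have tT : t <= t + 1 by rewrite lerDl.
pose K := expR (L * (1 + C) * (t + 1)) * (t + 1).
have K0 : 0 < K by rewrite mulr_gt0// expR_gt0.
(* the controls then contribute [K * (2 * L * eps) = e / 4] to the bound [LAS_gap] *)
pose eps := e / (8 * L * K).
have eps0 : 0 < eps by rewrite divr_gt0// mulr_gt0// mulr_gt0.
have e4 : 0 < e / 4 by rewrite divr_gt0.
apply: filterS (cvge0_lt hu_lim eps0) => k supk.
have u_close nu : ProbC nu -> (pseudo_wasserstein (u_ k nu) (u nu) < eps%:E)%E.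
  by move=> cnu; apply: le_lt_trans supk; apply: ereal_sup_ubound; exists nu.
have [_ [mk /(_ _ T0)[lask cvk]]] := hmu_ k.
have [_ [m /(_ _ T0)[las cv]]] := hmu.
near \oo%classic => N.
have N0 : (0 < N)%N by near: N; exists 1%N.
have lk : LAS (control_field hf (u_ k)) mu0 N (t + 1) (mk N) by near: N.
have lm : LAS (control_field hf u) mu0 N (t + 1) (m N) by near: N.
have near_t (nu nu' : R -> Prob R 'rV[R]_n) :
    (ereal_sup [set WRn (nu s) (nu' s) | s in `[0%R, (t + 1)%R]] < (e / 4)%:E)%E ->
    (WRn (nu t) (nu' t) <= (e / 4)%:E)%E.
  move=> h; apply/ltW; apply: le_lt_trans h; apply: ereal_sup_ubound.
  by exists t => //=; rewrite in_itv/= t0.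
have wk : (WRn (mk N t) (mu_ k t) <= (e / 4)%:E)%E.
  by apply: near_t; near: N; exact: cvge0_lt cvk e4.
have wm : (WRn (m N t) (mu t) <= (e / 4)%:E)%E.
  by apply: near_t; near: N; exact: cvge0_lt cv e4.
have gap := LAS_gap hfhat L0 fL (hu_ k) hu C0 eps0 (uC k) u_close N0 lk lm t0 tT.
have [D cD D0] := LAS_countable N0 lk t0 tT.
have [D' cD' D'0] := LAS_countable N0 lm t0 tT.
apply: le_trans (WRn_triangle (mu_ k t) (mu t) cD D0) _.
apply: (@le_trans _ _ ((e / 4)%:E + ((K * (2 * L * eps + 8 * n%:R / N%:R))%:E +
  (e / 4)%:E))%E).
  apply: leeD; first by rewrite /WRn wasserstein_sym//; [exact: euclid_dist_ge0
    |exact: measurable_edist_pair|exact: euclid_distC].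
  by apply: le_trans (WRn_triangle (mk N t) (mu t) cD' D'0) _; exact: leeD.
rewrite -!EFinD lee_fin mulrDr.
have -> : K * (2 * L * eps) = e / 4.
  by rewrite /eps; field; rewrite !gt_eqF.
have : K * (8 * n%:R / N%:R) <= e / 4; last by lra.
rewrite mulrA ler_pdivrMr ?ltr0n// -ler_pdivrMl//.
by near: N; exact: nbhs_infty_ger.
Unshelve. all: by end_near. Qed.
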